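(* Let $n\ge0$ and $1\le j<5$ be integers and let $p$ be a prime such that $p\equiv -1\pmod{2^j}$ and $\nu_p(n+1)\equiv -1\pmod{2^{5-j}}$. Then for all integers $\alpha\ge1$ and $\beta\ge0$, $$\overline{B}_{2^{\alpha}}(2^{\alpha+\beta+1}(n+1)) \equiv 0 \pmod{2^{3\beta+9}}.$$
   Context: $\nu_p(m)$ is the exponent of the highest power of the prime $p$ dividing $m$. For an integer $k\ge 2$, $\overline{B}_k(n)$ denotes the number of $k$-regular overpartition pairs of $n$ (pairs of overpartitions with no part divisible by $k$ and with total sum of parts $n$; an overpartition is a partition in which the last occurrence of each part size may be overlined). Its generating function, as a formal power series in $q$, is $$\sum_{n=0}^{\infty} \overline{B}_{k}(n) q^n =\frac{(-q;q)^2_\infty\,(q^k;q^k)^2_\infty}{(q;q)^2_\infty\, (-q^k;q^k)^2_\infty},$$ where $(x;q)_\infty=\prod_{i=0}^\infty(1-xq^i)$. *)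

(* Defs.v *)
From mathcomp Require Import all_boot all_order all_algebra.

Set Implicit Arguments.
Unset Strict Implicit.
Unset Printing Implicit Defensive.

(* [(a, b)] is an occurrence of the part [a], overlined iff [b = true]. *)
Definition part : Type := (nat * bool)%type.

(* Parts are listed in nonincreasing order. An overlined occurrence cannot be
   followed by the same size, i.e. only the last occurrence of each size may be
   overlined. *)
Definition may_precede : rel part :=
  fun x y => (y.1 < x.1) || ((y.1 == x.1) && ~~ x.2).

Definition is_overpartition (s : seq part) : bool :=
  all (fun x => 0 < x.1) s && sorted may_precede s.

Definition regular (k : nat) (s : seq part) : bool :=
  all (fun x => ~~ (k %| x.1)) s.

Definition weight (s : seq part) : nat := \sum_(x <- s) x.1.

(* In an overpartition pair of n every part is at most n and each component has
   at most n parts, so all of these pairs live in a finite type: sequences of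
   length at most n with entries in 'I_n.+1 * bool. *)
Definition bounded_parts (n : nat) : finType := n.-bseq ('I_n.+1 * bool)%type.

Definition parts (n : nat) (s : n.-bseq ('I_n.+1 * bool)) : seq part :=
  [seq (nat_of_ord x.1, x.2) | x <- s].

Definition is_regular_overpartition_pair (k n : nat) (s t : seq part) : bool :=
  [&& is_overpartition s, is_overpartition t, regular k s, regular k t
    & weight s + weight t == n].

Definition Bbar (k n : nat) : nat :=
  #|[set st : bounded_parts n * bounded_parts n
      | is_regular_overpartition_pair k n (parts st.1) (parts st.2)]|.

(* Main.v *)
Require Import Defs.
From mathcomp Require Import all_boot all_order all_algebra.
From HB Require Import structures.
From mathcomp Require Import boolp.
From mathcomp Require Import zify ring.

(** * Why the congruence holds

    Write [a] for the theta series sum_(s in Z) q^(s^2), [b] for its image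
    under q -> -q, and [P] for the generating series of overpartitions.
    Gauss's identity says [b * P = 1] ([gauss]), so the generating series of
    k-regular overpartition pairs is (b(q^k) / b(q))^2.  For k = 2^alpha two
    elementary identities for sums of two squares, a(q) b(q) = b(q^2)^2 and
    a(q)^2 + b(q)^2 = 2 a(q^2)^2, turn it into z(q) z(q^2) ... z(q^(2^(alpha-1)))
    with [z = a / b] ([reg_gf_pow2_sqr]), and they give the quadratic equation
    z(q)^2 + 1 = 2 z(q^2)^2 z(q) ([theta_quot_quad]).

    Let U be the operator that keeps the coefficients of even index, f_n ->
    f_(2n).  The theorem is about the coefficients of the series obtained from
    the generating series by applying U alpha + beta + 1 times.  The quadratic
    equation lets U act on polynomials in z, and hence on polynomials in
    [v = z^4 - 1].  Since v(q)^2 = 16 (v + v^2)(q^2) (v(q) + 1)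
    ([haupt_quad]), each application of U to v Z[v] produces a factor 8
    ([bisect_descent]).  After the first alpha + 1 applications the series is
    1 + 2 v + 64 v f(v), and after beta more it is
    1 + 2 8^beta (c v + d v^2 + 16 v f(v)), with f in Z[v] and c, d integers
    ([valuation_form_iter]).  All coefficients of v are divisible by 16, so the
    theorem follows once the coefficient of v at n + 1 is divisible by 256.

    The arithmetic of v comes from logarithmic derivatives.  The product for [P]
    gives D b = - 2 L b, where D = q d/dq and L is the Lambert series
    with coefficients sum_(d | n, n/d odd) d.  The series
    E = 4 (D a / a - D b / b) - (a^4 - b^4) satisfies
    4 (a^2 + b^2)(q) E(q^2) = (a^2 - b^2)(q) E(q), a consequence of the same two
    identities; comparing the orders of the two sides at q = 0 forces E = 0
    ([four_defect_eq0]), so that a^4 - b^4 = 16 O with O the odd part of L.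
    This is Jacobi's four-square theorem for odd integers.  Differentiating once
    more shows that v_n = 16 n sigma(n) modulo 256 for odd n ([haupt16_odd]),
    while U v = 8 (v + v^2) reduces even indices to odd ones.  Finally the
    hypotheses on p make 16 divide
    1 + p + ... + p^e = (1 + p)(1 + p^2)(1 + p^4) ..., e = nu_p(n + 1), which is
    a factor of sigma of the odd part of n + 1 ([sigma_dvd16]). *)

Set Implicit Arguments.
Unset Strict Implicit.
Unset Printing Implicit Defensive.
Import GRing.Theory Num.Theory.
Local Open Scope ring_scope.

(** * Integral formal power series *)

(** A record rather than [nat -> int] itself, so that the Cauchy product does
    not compete with pointwise operations on functions. *)
Record fps := Fps { coefs : nat -> int }.
Coercion coefs : fps >-> Funclass.

Lemma fpsP (f g : fps) : f =1 g -> f = g.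
Proof. by case: f g => [f] [g] /= /funext ->. Qed.

HB.instance Definition _ := gen_eqMixin fps.
HB.instance Definition _ := gen_choiceMixin fps.

Definition fps_add (f g : fps) := Fps (fun n => f n + g n).
Definition fps_opp (f : fps) := Fps (fun n => - f n).
Definition fps_mul (f g : fps) :=
  Fps (fun n => \sum_(i < n.+1) f i * g (n - i)%N).

Fact fps_addA : associative fps_add.
Proof. by move=> f g h; apply: fpsP => n /=; rewrite addrA. Qed.
Fact fps_addC : commutative fps_add.
Proof. by move=> f g; apply: fpsP => n /=; rewrite addrC. Qed.
Fact fps_add0 : left_id (Fps (fun=> 0)) fps_add.
Proof. by move=> f; apply: fpsP => n /=; rewrite add0r. Qed.
Fact fps_addN : left_inverse (Fps (fun=> 0)) fps_opp fps_add.
Proof. by move=> f; apply: fpsP => n /=; rewrite addNr. Qed.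

HB.instance Definition _ :=
  GRing.isZmodule.Build fps fps_addA fps_addC fps_add0 fps_addN.

Definition trunc (N : nat) (f : fps) : {poly int} := \poly_(i < N) f i.

Lemma coef_trunc N (f : fps) n : (n < N)%N -> (trunc N f)`_n = f n.
Proof. by move=> ltnN; rewrite coef_poly ltnN. Qed.

Lemma fps_mulE f g n :
  fps_mul f g n = \sum_(i < n.+1) f i * g (n - i)%N.
Proof. by []. Qed.

(** A coefficient of a product is one of a product of polynomials; this is how
    the ring laws are inherited from [{poly int}]. *)
Lemma fps_mul_trunc N f g n : (n < N)%N ->
  fps_mul f g n = (trunc N f * trunc N g)`_n.
Proof.
move=> ltnN; rewrite coefM /=; apply: eq_bigr => i _.
by rewrite !coef_trunc // (leq_ltn_trans _ ltnN) ?leq_subr // -ltnS.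
Qed.

Fact fps_mulA : associative fps_mul.
Proof.
move=> f g h; apply: fpsP => n; rewrite [LHS]fps_mulE [RHS]fps_mulE; pose t := trunc n.+1.
transitivity (t f * (t g * t h))`_n; last rewrite mulrA.
  rewrite coefM; apply: eq_bigr => i _.
  by rewrite coef_trunc // (@fps_mul_trunc n.+1) ?ltnS ?leq_subr.
rewrite coefM; apply: eq_bigr => i _.
by rewrite (@fps_mul_trunc n.+1) // coef_trunc // ltnS leq_subr.
Qed.
Fact fps_mulC : commutative fps_mul.
Proof.
move=> f g; apply: fpsP => n.
by rewrite !(@fps_mul_trunc n.+1) // mulrC.
Qed.
Fact fps_mul1 : left_id (Fps (fun n => (n == 0%N)%:R)) fps_mul.
Proof.
move=> f; apply: fpsP => n /=; rewrite big_ord_recl mul1r subn0.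
by rewrite big1 ?addr0 // => i _; rewrite mul0r.
Qed.
Fact fps_mulDl : left_distributive fps_mul fps_add.
Proof.
move=> f g h; apply: fpsP => n /=; rewrite -big_split /=.
by apply: eq_bigr => i _; rewrite mulrDl.
Qed.
Fact fps_one_neq0 : Fps (fun n => (n == 0%N)%:R) != 0.
Proof. by apply/eqP => /(congr1 (fun f : fps => f 0%N)). Qed.

HB.instance Definition _ :=
  GRing.Zmodule_isComNzRing.Build fps fps_mulA fps_mulC fps_mul1 fps_mulDl
    fps_one_neq0.

Implicit Types f g h : fps.

Lemma coefsD f g n : (f + g) n = f n + g n. Proof. by []. Qed.
Lemma coefsN f n : (- f) n = - f n. Proof. by []. Qed.
Lemma coefsB f g n : (f - g) n = f n - g n. Proof. by []. Qed.
Lemma coefs0 n : (0 : fps) n = 0. Proof. by []. Qed.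
Lemma coefs1 n : (1 : fps) n = (n == 0%N)%:R. Proof. by []. Qed.
Lemma coefsM f g n : (f * g) n = \sum_(i < n.+1) f i * g (n - i)%N.
Proof. by []. Qed.
Lemma coefsMn f k n : (f *+ k) n = f n *+ k.
Proof. by elim: k => // k IH; rewrite !mulrS coefsD IH. Qed.
Lemma coefs_sum I (r : seq I) (Q : pred I) (F : I -> fps) n :
  (\sum_(i <- r | Q i) F i) n = \sum_(i <- r | Q i) F i n.
Proof. by elim/big_rec2: _ => // i x f _ <-. Qed.
Lemma coefs_int (c : int) f n : (c%:~R * f) n = c * f n.
Proof.
case: c => k; rewrite ?NegzE ?rmorphN ?mulNr ?coefsN; congr (- _) || idtac;
by rewrite -?pmulrn mulr_natl coefsMn -mulr_natl natz.
Qed.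
Lemma coefs_nat (k : nat) f n : (k%:R * f) n = k%:R * f n.
Proof. by rewrite mulr_natl coefsMn mulr_natl. Qed.
Lemma coefsM0 f g : (f * g) 0%N = f 0%N * g 0%N.
Proof. by rewrite coefsM big_ord1. Qed.

Lemma coefsM_eq n f f' g g' : (forall i, (i <= n)%N -> f i = f' i) ->
  (forall i, (i <= n)%N -> g i = g' i) -> (f * g) n = (f' * g') n.
Proof.
move=> ff' gg'; rewrite !coefsM; apply: eq_bigr => i _.
by rewrite ff' ?gg' ?leq_subr // -ltnS.
Qed.

Definition qpow (m : nat) : fps := Fps (fun n => (n == m)%:R).

Lemma coefs_qpowM m f n : (qpow m * f) n = if (m <= n)%N then f (n - m)%N else 0.
Proof.
rewrite coefsM; case: leqP => [le_mn | lt_nm].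
  rewrite (bigD1 (inord m)) //= inordK ?ltnS // eqxx mul1r big1 ?addr0 // => i.
  by rewrite -val_eqE /= inordK ?ltnS // => /negPf ->; rewrite mul0r.
rewrite big1 // => i _ /=; case: eqP => [eq_im | _]; last by rewrite mul0r.
by have := ltn_ord i; rewrite eq_im; lia.
Qed.

Lemma qpow0 : qpow 0 = 1. Proof. exact: fpsP. Qed.

Lemma qpowD m n : qpow (m + n) = qpow m * qpow n.
Proof.
apply: fpsP => i; rewrite coefs_qpowM /=; case: leqP => le_mi.
  by have -> : (i == m + n)%N = (i - m == n)%N by lia.
by have -> : (i == m + n)%N = false by lia.
Qed.

(** * Substitutions, bisection and the Euler derivation *)

(** The substitutions q -> -q and q -> q^2, Atkin's operator U_2, and q d/dq. *)
Definition qneg f : fps := Fps (fun n => (-1) ^+ n * f n).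
Definition dilate f : fps := Fps (fun n => if odd n then 0 else f n./2).
Definition bisect f : fps := Fps (fun n => f n.*2).
Definition euler f : fps := Fps (fun n => n%:R * f n).

Lemma coefs_qneg f n : qneg f n = (-1) ^+ n * f n. Proof. by []. Qed.
Lemma coefs_dilate f n : dilate f n = if odd n then 0 else f n./2. Proof. by []. Qed.
Lemma coefs_dilate_double f n : dilate f n.*2 = f n.
Proof. by rewrite coefs_dilate odd_double doubleK. Qed.
Lemma coefs_bisect f n : bisect f n = f n.*2. Proof. by []. Qed.
Lemma coefs_euler f n : euler f n = n%:R * f n. Proof. by []. Qed.

Fact qneg_is_zmod_morphism : zmod_morphism qneg.
Proof. by move=> f g; apply: fpsP => n /=; rewrite mulrBr. Qed.
HB.instance Definition _ :=
  GRing.isZmodMorphism.Build fps fps qneg qneg_is_zmod_morphism.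

Fact qneg_is_monoid_morphism : monoid_morphism qneg.
Proof.
split; first by apply: fpsP => -[|n] //; rewrite coefs_qneg mulr0.
move=> f g; apply: fpsP => n; rewrite coefs_qneg !coefsM mulr_sumr.
apply: eq_bigr => i _; rewrite !coefs_qneg mulrACA -exprD subnKC //.
by rewrite -ltnS.
Qed.
HB.instance Definition _ :=
  GRing.isMonoidMorphism.Build fps fps qneg qneg_is_monoid_morphism.

Fact dilate_is_zmod_morphism : zmod_morphism dilate.
Proof.
by move=> f g; apply: fpsP => n /=; case: odd; rewrite ?subr0.
Qed.
HB.instance Definition _ :=
  GRing.isZmodMorphism.Build fps fps dilate dilate_is_zmod_morphism.

Fact bisect_is_zmod_morphism : zmod_morphism bisect.
Proof. by move=> f g; apply: fpsP. Qed.
HB.instance Definition _ :=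
  GRing.isZmodMorphism.Build fps fps bisect bisect_is_zmod_morphism.

Fact euler_is_zmod_morphism : zmod_morphism euler.
Proof. by move=> f g; apply: fpsP => n /=; rewrite mulrBr. Qed.
HB.instance Definition _ :=
  GRing.isZmodMorphism.Build fps fps euler euler_is_zmod_morphism.

Lemma bisect_dilate f : bisect (dilate f) = f.
Proof. by apply: fpsP => n; rewrite coefs_bisect coefs_dilate_double. Qed.

Lemma qneg_dilate f : qneg (dilate f) = dilate f.
Proof.
apply: fpsP => n; rewrite coefs_qneg coefs_dilate -signr_odd.
by case: odd; rewrite ?mulr0 ?mul1r.
Qed.

Lemma qnegK f : qneg (qneg f) = f.
Proof. by apply: fpsP => n; rewrite !coefs_qneg mulrA -expr2 sqrr_sign mul1r. Qed.

Lemma addr_qneg f : f + qneg f = 2 * dilate (bisect f).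
Proof.
apply: fpsP => n; rewrite coefsD coefs_nat coefs_qneg coefs_dilate coefs_bisect.
rewrite -signr_odd; case: ifPn => [odd_n|even_n].
  by rewrite expr1 mulN1r subrr mulr0.
by rewrite expr0 mul1r even_halfK // mulr_natl.
Qed.

Lemma mul2fI f g : 2 * f = 2 * g -> f = g.
Proof.
move=> eq_fg; apply: fpsP => n.
have : (2 * f) n = (2 * g) n by rewrite eq_fg.
by rewrite !coefs_nat; lia.
Qed.

Lemma qneg_fixP f : qneg f = f -> f = dilate (bisect f).
Proof. by move=> fixf; apply: mul2fI; rewrite -addr_qneg fixf mulr2n mulrDl mul1r. Qed.

Lemma sum_even_terms n (F : nat -> int) : (forall i, odd i -> F i = 0) ->
  \sum_(i < n.*2.+1) F i = \sum_(i < n.+1) F i.*2.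
Proof.
move=> F0; elim: n => [|n IH]; first by rewrite !big_ord1.
rewrite doubleS [LHS]big_ord_recr big_ord_recr /= IH [RHS]big_ord_recr /=.
by rewrite F0 ?addr0 //= odd_double.
Qed.

(** U is linear over series in q^2: this is what makes it computable on the
    powers of a series that satisfies an equation over such series. *)
Lemma bisect_dilateM f g : bisect (dilate f * g) = f * bisect g.
Proof.
apply: fpsP => n; rewrite coefs_bisect !coefsM.
rewrite (@sum_even_terms n (fun i => dilate f i * g (n.*2 - i)%N)) => [|i odd_i].
  apply: eq_bigr => i _.
  by rewrite coefs_dilate_double coefs_bisect doubleB.
by rewrite coefs_dilate odd_i mul0r.
Qed.

Fact dilate_is_monoid_morphism : monoid_morphism dilate.
Proof.
split; first by apply: fpsP => -[|[|n]] //=; rewrite negbK; case: odd.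
move=> f g; rewrite (@qneg_fixP (dilate f * dilate g)); last by rewrite rmorphM /= !qneg_dilate.
by rewrite bisect_dilateM bisect_dilate.
Qed.
HB.instance Definition _ :=
  GRing.isMonoidMorphism.Build fps fps dilate dilate_is_monoid_morphism.

Lemma eulerM f g : euler (f * g) = euler f * g + f * euler g.
Proof.
apply: fpsP => n; rewrite coefsD coefs_euler !coefsM mulr_sumr -big_split.
apply: eq_bigr => i _; rewrite !coefs_euler /=.
have -> : n%:R = i%:R + (n - i)%:R :> int.
  by rewrite -natrD subnKC // -ltnS.
by rewrite mulrDl mulrA mulrCA.
Qed.

Lemma euler1 : euler 1 = 0.
Proof. by apply: fpsP => -[|n]; rewrite coefs_euler ?mul0r ?mulr0. Qed.

Lemma euler_dilate f : euler (dilate f) = 2 * dilate (euler f).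
Proof.
apply: fpsP => n; rewrite coefs_nat coefs_euler !coefs_dilate coefs_euler.
case: ifPn => [|even_n]; first by rewrite !mulr0.
by rewrite mulrA -natrM mul2n even_halfK.
Qed.

Lemma euler_qneg f : euler (qneg f) = qneg (euler f).
Proof. by apply: fpsP => n; rewrite !(coefs_euler, coefs_qneg) mulrCA. Qed.

Lemma euler_qpow m : euler (qpow m) = m%:R * qpow m.
Proof.
apply: fpsP => n; rewrite coefs_euler coefs_nat /=.
by case: eqP => [->//|_]; rewrite !mulr0.
Qed.

Lemma dilate_qpow m : dilate (qpow m) = qpow m.*2.
Proof.
apply: fpsP => n; rewrite coefs_dilate /=; case: ifPn => [odd_n|even_n].
  by case: eqP odd_n => // ->; rewrite odd_double.
by rewrite -{2}(even_halfK even_n) (inj_eq double_inj).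
Qed.

(** * Theta series and sums of two squares *)

Definition square_series : fps :=
  Fps (fun n => \sum_(1 <= k < n.+1) ((k ^ 2)%N == n)%:R).

Definition theta : fps := 1 + 2 * square_series.
Definition theta_neg : fps := qneg theta.

Lemma coefs_square_series N n : (n <= N)%N ->
  square_series n = \sum_(1 <= k < N.+1) ((k ^ 2)%N == n)%:R.
Proof.
move=> le_nN; rewrite [RHS](big_cat_nat (n := n.+1)) //=.
rewrite [X in _ + X]big1_seq ?addr0 // => k /andP[_].
rewrite mem_index_iota => /andP[lt_nk _].
case: eqP => // k2; exfalso; move: lt_nk; rewrite -k2 -mulnn; nia.
Qed.

Lemma theta_eq0 n : (forall x, n <> (x ^ 2)%N) -> theta n = 0.
Proof.
move=> nsq; rewrite coefsD coefs_nat coefs1; case: eqP => [n0|_].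
  by have := nsq 0%N; rewrite n0.
rewrite (coefs_square_series (leqnn n)) big1 // => k _; case: eqP => // k2; by have := nsq k; rewrite k2.
Qed.

Definition int_ball (N : nat) : seq int :=
  0 :: [seq k%:Z | k <- iota 1 N] ++ [seq - k%:Z | k <- iota 1 N].

Lemma mem_int_ball N (x : int) : (x \in int_ball N) = (`|x| <= N)%N.
Proof.
rewrite inE mem_cat; apply/idP/idP => [|le_xN].
  by case/or3P => [/eqP ->//|/mapP|/mapP] [k]; rewrite mem_iota => ? ->; lia.
case: (ltrgt0P x) => [x_gt0|x_lt0|->]; rewrite ?eqxx //= orbC.
  by apply/orP; right; apply/mapP; exists `|x|%N; rewrite ?mem_iota; lia.
by apply/orP; left; apply/mapP; exists `|x|%N; rewrite ?mem_iota; lia.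
Qed.

Lemma int_ball_uniq N : uniq (int_ball N).
Proof.
rewrite cons_uniq mem_cat cat_uniq !map_inj_uniq ?iota_uniq ?andbT /=.
- apply/andP; split.
    by apply/norP; split; apply/mapP => -[k]; rewrite mem_iota; lia.
  apply/hasPn => x /mapP[k]; rewrite mem_iota => k_gt0 ->.
  by apply/mapP => -[l]; rewrite mem_iota; lia.
- by move=> x y /oppr_inj [].
- by move=> ? ? [].
Qed.

Lemma theta_count N n : (n <= N)%N ->
  theta n = \sum_(x <- int_ball N) (x ^+ 2 == n%:Z)%:R.
Proof.
move=> le_nN; rewrite coefsD coefs1 coefs_nat (coefs_square_series le_nN).
rewrite big_cons big_cat !big_map /= mulr_natl mulr2n /index_iota subSS subn0.
congr (_ + _); first by rewrite expr0n /= eqz_nat eq_sym.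
by congr (_ + _); apply: eq_bigr => k _; rewrite ?sqrrN -natz -natrX -[n%:Z]natz eqr_nat.
Qed.

Lemma sqrz_abs (x : int) : x ^+ 2 = (`|x| ^ 2)%N%:Z.
Proof. by rewrite -abszX gez0_abs // sqr_ge0. Qed.

Lemma theta2_count N n : (n <= N)%N ->
  (theta ^+ 2) n = \sum_(x <- int_ball N) \sum_(y <- int_ball N)
    (x ^+ 2 + y ^+ 2 == n%:Z)%:R.
Proof.
move=> le_nN; rewrite expr2 coefsM.
have th i : (i < n.+1)%N ->
    theta i * theta (n - i)%N = \sum_(x <- int_ball N) \sum_(y <- int_ball N)
      ((x ^+ 2 == i%:Z)%:R * (y ^+ 2 == (n - i)%N%:Z)%:R).
  move=> lt_in; rewrite (@theta_count N i) ?(@theta_count N (n - i)); try lia.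
  by rewrite mulr_suml; apply: eq_bigr => x _; rewrite mulr_sumr.
rewrite (eq_bigr _ (fun (i : 'I_n.+1) _ => th i (ltn_ord i))) exchange_big.
apply: eq_bigr => x _; rewrite exchange_big; apply: eq_bigr => y _ /=.
rewrite !sqrz_abs -PoszD eqz_nat; set X := (_ ^ 2)%N; set Y := (_ ^ 2)%N.
have [le_Xn|lt_nX] := leqP X n; last first.
  rewrite big1 => [|i _]; first by have -> : (X + Y == n)%N = false by lia.
  have lt_in := ltn_ord i; rewrite eqz_nat.
  by rewrite (_ : (X == i)%N = false) ?mul0r //; lia.
rewrite (bigD1 (inord X)) //= inordK ?ltnS // big1 ?addr0 => [|i].
  by rewrite eqxx mul1r eqz_nat; have -> : (Y == n - X)%N = (X + Y == n)%N by lia.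
rewrite -val_eqE /= inordK ?ltnS // eqz_nat eq_sym => /negPf ->.
by rewrite mul0r.
Qed.

Lemma sum_count (T : Type) (s : seq T) (C : pred T) :
  \sum_(x <- s) (C x)%:R = (count C s)%:R :> int.
Proof. by rewrite -natr_sum -sum1_count [in RHS]big_mkcond. Qed.

Lemma sum_sq_bound (x y : int) (n : nat) :
  x ^+ 2 + y ^+ 2 = n -> (`|x| + `|y| <= n)%N.
Proof.
have le_sq (t : int) : (`|t|%N : int) <= t ^+ 2 by rewrite expr2; nia.
by have := le_sq x; have := le_sq y; lia.
Qed.

Lemma sum_sq_even (x y : int) (n : nat) : x ^+ 2 + y ^+ 2 = n.*2 ->
  exists c d, x = c + d /\ y = c - d.
Proof.
have halve (t : int) : exists r, t = 2 * r \/ t = 2 * r + 1.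
  by exists (t %/ 2)%Z; lia.
have [r [] ->] := halve x; have [s [] ->] := halve y => xy.
- by exists (r + s), (r - s); split; ring.
- suff : 2 * (2 * r ^+ 2 + 2 * s ^+ 2 + 2 * s) + 1 = n.*2 by lia.
  by rewrite -xy; ring.
- suff : 2 * (2 * r ^+ 2 + 2 * s ^+ 2 + 2 * r) + 1 = n.*2 by lia.
  by rewrite -xy; ring.
- by exists (r + s + 1), (r - s); split; ring.
Qed.

(** The integers 2n and n have equally many representations as sums of two
    square_series, because (c, d) -> (c + d, c - d) sends those of n to those of 2n,
    and x, y have the same parity whenever x^2 + y^2 is even. *)
Lemma bisect_theta2 : bisect (theta ^+ 2) = theta ^+ 2.
Proof.
apply: fpsP => n; rewrite coefs_bisect.
rewrite (@theta2_count n.*2 n.*2) // (@theta2_count n.*2 n) -?addnn ?leq_addr //.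
rewrite addnn; set s := [seq (x, y) | x <- int_ball n.*2, y <- int_ball n.*2].
have countE m : \sum_(x <- int_ball n.*2) \sum_(y <- int_ball n.*2)
    (x ^+ 2 + y ^+ 2 == m)%:R = (count (fun p => p.1 ^+ 2 + p.2 ^+ 2 == m) s)%:R :> int.
  by rewrite -sum_count big_allpairs.
rewrite !countE {countE}.
have uniq_s : uniq s.
  by apply: allpairs_uniq; rewrite ?int_ball_uniq // => -[? ?] [? ?].
have mem_s p : (p \in s) = (`|p.1| <= n.*2)%N && (`|p.2| <= n.*2)%N.
  case: p => x y; rewrite -!mem_int_ball; apply/allpairsP/andP.
    by case=> -[? ?] /= [? ? [-> ->]].
  by case=> ? ?; exists (x, y).
clearbody s; pose rot (p : int * int) := (p.1 + p.2, p.1 - p.2).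
have rot_inj : injective rot by move=> [x y] [x' y'] [eq1 eq2]; congr (_, _); lia.
congr _%:R; rewrite -!size_filter -[RHS](size_map rot).
apply/perm_size/uniq_perm; rewrite ?(map_inj_uniq rot_inj) ?filter_uniq // => -[x y].
rewrite mem_filter mem_s /=.
have rotE (c d : int) : (c + d) ^+ 2 + (c - d) ^+ 2 = 2 * (c ^+ 2 + d ^+ 2) by ring.
apply/idP/idP => [/andP[/eqP xy _] | /mapP[[c d]]].
  have [c [d [xE yE]]] := sum_sq_even xy; apply/mapP; exists (c, d); last by rewrite xE yE.
  have cd : c ^+ 2 + d ^+ 2 = n by move: xy; rewrite xE yE rotE; lia.
  rewrite mem_filter mem_s /= cd eqxx /=.
  by have := sum_sq_bound cd; lia.
rewrite mem_filter mem_s /= => /andP[/eqP cd _] [-> ->].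
rewrite rotE cd; have := sum_sq_bound cd; lia.
Qed.

Lemma sum_sq_parity x y n : (x ^ 2 + y ^ 2 = n.*2)%N -> odd x = odd n.
Proof.
rewrite -(odd_double_half x) -(odd_double_half y) oddD odd_double.
move: (x./2) (y./2) => a b; case: (odd x); case: (odd y); rewrite -!mulnn -!muln2.
all: rewrite /= => xy.
- have -> : n = (a * a + a + b * b + b).*2.+1 by lia.
  by rewrite /= odd_double.
- by lia.
- by lia.
- have -> : n = (a * a + b * b).*2 by lia.
  by rewrite odd_double.
Qed.

Lemma theta_neg2 : theta_neg ^+ 2 = qneg (theta ^+ 2).
Proof. by rewrite rmorphXn. Qed.

(** In a representation x^2 + y^2 = 2n the sign (-1)^y is that of n, so the
    sign can be taken out of the convolution. *)
Lemma bisect_theta_mul_neg : bisect (theta * theta_neg) = theta_neg ^+ 2.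
Proof.
apply: fpsP => n; rewrite theta_neg2 coefs_qneg -bisect_theta2 !coefs_bisect expr2.
rewrite !coefsM mulr_sumr; apply: eq_bigr => i _.
rewrite coefs_qneg mulrCA.
have is_square m : (forall x, m <> x ^ 2)%N \/ exists x, m = (x ^ 2)%N.
  case: (boolP [exists x : 'I_m.+1, m == (x ^ 2)%N]) => [/existsP[x /eqP ->]|nsq].
    by right; exists x.
  left=> x xE; case/existsP: nsq; exists (inord x).
  rewrite inordK xE ?eqxx // ltnS -mulnn.
  by case: (x) => // y; rewrite leq_pmull.
have [nsq|[x xE]] := is_square i.
  by rewrite (theta_eq0 nsq) !(mul0r, mulr0).
have [nsq|[y yE]] := is_square (n.*2 - i)%N.
  by rewrite (theta_eq0 nsq) !(mul0r, mulr0).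
congr (_ * _); rewrite yE -signr_odd oddX (@sum_sq_parity y x n) ?signr_odd //.
by rewrite -xE -yE subnK // -ltnS.
Qed.

Lemma theta_mul_neg : theta * theta_neg = dilate (theta_neg ^+ 2).
Proof.
rewrite -bisect_theta_mul_neg; apply: qneg_fixP.
by rewrite rmorphM /= qnegK mulrC.
Qed.

Lemma theta2D : theta ^+ 2 + theta_neg ^+ 2 = 2 * dilate (theta ^+ 2).
Proof. by rewrite theta_neg2 addr_qneg bisect_theta2. Qed.

(** * The identity of Gauss for the sum of (-1)^s q^(s^2) *)

(** The series 1 / (1 - q^k). *)
Definition geometric (k : nat) : fps := Fps (fun n => (k %| n)%:R).

Lemma geometricE k : (0 < k)%N -> (1 - qpow k) * geometric k = 1.
Proof.
move=> k_gt0; apply: fpsP => n; rewrite mulrBl mul1r coefsB coefs_qpowM /=.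
have [le_kn|lt_nk] := leqP k n.
  by rewrite dvdn_subl // subrr; case: n le_kn => //; lia.
rewrite subr0; case: n lt_nk => [|n] lt_nk; first by rewrite dvdn0.
by rewrite gtnNdvd.
Qed.

(** The Euler factor of parts of size k in overpartitions: any number of
    plain occurrences, the last of which may be overlined. *)
Definition over_factor (k : nat) : fps := (1 + qpow k) * geometric k.
(** The inverse of [over_factor], written with 1 / (1 - q^(2k)) in place of an
    inverse of 1 + q^k. *)
Definition over_factor_inv (k : nat) : fps := (1 - qpow k) ^+ 2 * geometric k.*2.
Definition one_plus_inv (k : nat) : fps := (1 - qpow k) * geometric k.*2.

Lemma one_plus_invE k : (0 < k)%N -> (1 + qpow k) * one_plus_inv k = 1.
Proof.
move=> k_gt0; transitivity ((1 - qpow k.*2) * geometric k.*2); last first.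
  by rewrite geometricE // double_gt0.
have -> : qpow k.*2 = qpow k * qpow k by rewrite -addnn qpowD.
by rewrite /one_plus_inv; ring.
Qed.

Lemma over_factor_invE k : over_factor_inv k = (1 - qpow k) * one_plus_inv k.
Proof. rewrite /over_factor_inv /one_plus_inv; ring. Qed.

Lemma over_factorV k : (0 < k)%N -> over_factor k * over_factor_inv k = 1.
Proof.
move=> k_gt0; rewrite over_factor_invE /over_factor.
have -> : (1 + qpow k) * geometric k * ((1 - qpow k) * one_plus_inv k) =
  ((1 + qpow k) * one_plus_inv k) * ((1 - qpow k) * geometric k) by ring.
by rewrite one_plus_invE // geometricE // mulr1.
Qed.

Definition inv_prod (s n : nat) : fps := \prod_(s <= k < n.+1) over_factor_inv k.

(** Summand of a finite form, in the style of Shanks, of the identity of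
    Gauss: the partial theta sum up to n differs from the product
    prod_(k <= n) (1 - q^k) / (1 + q^k) by terms divisible by q^(n+1). *)
Definition gauss_tail (n s : nat) : fps :=
  inv_prod s.+1 n * one_plus_inv s * qpow (s * n.+1).

(** Passing from n to n + 1 changes the s-th term by -P X (A_(s-1) + A_s), with
    X = q^(n+1), P = 1 / (1 + X) and A_s = q^(s (n+1)) prod_(s < k <= n)
    (1 - q^k) / (1 + q^k), so the alternating sum of the changes telescopes. *)
Lemma gauss_tail_step n r : (r <= n)%N ->
  \sum_(1 <= s < r.+1) (-1) ^+ s * gauss_tail n.+1 s =
  \sum_(1 <= s < r.+1) (-1) ^+ s * gauss_tail n s +
   one_plus_inv n.+1 * qpow n.+1 *
     (inv_prod 1 n - (-1) ^+ r * (inv_prod r.+1 n * qpow (r * n.+1))).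
Proof.
elim: r => [|r IH] le_rn.
  by rewrite !big_geq // mul0n qpow0 expr0 mul1r mulr1 subrr mulr0 addr0.
rewrite !(@big_nat_recr _ _ _ r.+1 1) //= IH ?(ltnW le_rn) //.
rewrite /gauss_tail.
rewrite [inv_prod r.+2 n.+1]big_nat_recr //= -/(inv_prod _ _).
rewrite [inv_prod r.+1 n]big_ltn // -/(inv_prod _ _).
rewrite (_ : (r.+1 * n.+2 = r * n.+1 + n.+1 + r.+1)%N); last by lia.
rewrite (_ : (r.+1 * n.+1 = r * n.+1 + n.+1)%N); last by lia.
rewrite !qpowD !over_factor_invE (exprS _ r).
have er : (1 + qpow r.+1) * one_plus_inv r.+1 = 1 by rewrite one_plus_invE.
have en : (1 + qpow n.+1) * one_plus_inv n.+1 = 1 by rewrite one_plus_invE.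
set x := qpow r.+1 in er *; set X := qpow n.+1 in en *; set p := one_plus_inv r.+1 in er *.
set P := one_plus_inv n.+1 in en *; set Z := qpow (r * n.+1); set R := inv_prod r.+2 n.
set A0 := inv_prod 1 n; set S := \sum_(_ <= _ < _) _; set e := (-1) ^+ r.
have key : p - P * X = P * p * (1 - X * x).
  transitivity (p * ((1 + X) * P) - P * X * ((1 + x) * p)); last by ring.
  by rewrite en er !mulr1.
transitivity (S + P * X * A0 - e * R * Z * X * (p - P * X)); last by ring.
by rewrite key; ring.
Qed.

Definition theta_neg_trunc (n : nat) : fps :=
  1 + 2 * \sum_(1 <= s < n.+1) (-1) ^+ s * qpow (s ^ 2).

Lemma finite_gauss n : theta_neg_trunc n =
  inv_prod 1 n + 2 * \sum_(1 <= s < n.+1) (-1) ^+ s * gauss_tail n s.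
Proof.
elim: n => [|n IH].
  by rewrite /theta_neg_trunc /inv_prod !big_geq // !mulr0 addr0.
rewrite /theta_neg_trunc big_nat_recr //= mulrDr addrA -/(theta_neg_trunc n) IH.
rewrite [in RHS]big_nat_recr //= gauss_tail_step //.
rewrite /gauss_tail /inv_prod [\prod_(1 <= k < n.+2) _]big_nat_recr //=.
rewrite -/(inv_prod 1 n) !(@big_geq _ _ _ n.+1) // !(@big_geq _ _ _ n.+2) //.
rewrite (_ : n.+1 ^ 2 = n * n.+1 + n.+1)%N; last by rewrite -mulnn; lia.
rewrite (_ : n.+1 * n.+2 = n * n.+1 + n.+1 + n.+1)%N; last by lia.
rewrite !qpowD over_factor_invE exprS.
have en : (1 + qpow n.+1) * one_plus_inv n.+1 = 1 by rewrite one_plus_invE.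
set X := qpow n.+1 in en *; set P := one_plus_inv n.+1 in en *; set Z := qpow (n * n.+1).
set S := \sum_(_ <= _ < _) _; set A0 := inv_prod 1 n; set e := (-1) ^+ n.
transitivity (A0 * ((1 + X) * P) + 2 * S - 2 * e * Z * X * ((1 + X) * P)).
  by rewrite en; ring.
by ring.
Qed.

(** * Generating series of regular overpartitions *)

(** Factors of high index do not affect low coefficients, so the infinite
    products below make sense coefficientwise. *)
Lemma over_factorM_low k f n : (0 < k)%N -> (n < k)%N -> (over_factor k * f) n = f n.
Proof.
move=> k_gt0 lt_nk.
have -> : over_factor k * f = f + qpow k * (2 * geometric k * f).
  have geoX : geometric k = 1 + qpow k * geometric k by rewrite -[X in X + _](geometricE k_gt0); ring.
  by rewrite /over_factor mulrDl mul1r {1}geoX; ring.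
by rewrite coefsD coefs_qpowM leqNgt lt_nk addr0.
Qed.

Definition reg_prod (k m : nat) : fps :=
  \prod_(1 <= i < m.+1 | ~~ (k %| i)%N) over_factor i.

(** The infinite product, each coefficient being read off a partial product
    that is long enough; [k = 0] imposes no restriction on positive parts. *)
Definition reg_gf (k : nat) : fps := Fps (fun n => reg_prod k n n).

Lemma reg_prod0 k : reg_prod k 0 = 1.
Proof. by rewrite /reg_prod big_geq. Qed.

Lemma reg_prodS k m :
  reg_prod k m.+1 = (if (k %| m.+1)%N then 1 else over_factor m.+1) * reg_prod k m.
Proof.
rewrite /reg_prod big_mkcond big_nat_recr //= -big_mkcond /= mulrC.
by case: dvdn.
Qed.

Lemma reg_prod_stable k m n : (n <= m)%N -> reg_prod k m n = reg_gf k n.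
Proof.
elim: m => [|m IH]; first by rewrite leqn0 => /eqP ->.
rewrite leq_eqVlt => /orP[/eqP ->//|lt_nm]; rewrite reg_prodS.
by case: ifP => _; rewrite ?mul1r ?over_factorM_low ?IH.
Qed.

Lemma dilate_geometric k : (0 < k)%N -> dilate (geometric k) = geometric k.*2.
Proof.
move=> k_gt0; apply: fpsP => n; rewrite coefs_dilate /=.
case: ifPn => [odd_n|even_n]; last first.
  by rewrite -{2}(even_halfK even_n) -!muln2 dvdn_pmul2r.
case: (boolP (k.*2 %| n)%N) => // /dvdnP[c nE].
by rewrite nE -doubleMr odd_double in odd_n.
Qed.

Lemma dilate_over_factor k : (0 < k)%N -> dilate (over_factor k) = over_factor k.*2.
Proof.
by move=> k_gt0; rewrite /over_factor rmorphM rmorphD rmorph1 /= dilate_qpow dilate_geometric.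
Qed.

Lemma reg_prod_double k m :
  reg_prod k.*2 m.*2 = reg_prod 2 m.*2 * dilate (reg_prod k m).
Proof.
elim: m => [|m IH]; first by rewrite !reg_prod0 rmorph1 mulr1.
rewrite doubleS !reg_prodS IH rmorphM /= -doubleS -!muln2 dvdn_pmul2r //.
rewrite dvdn_mull // mul1r.
have odd_step d : (d * 2 %| (m * 2).+1)%N = false.
  by apply: contraNF (_ : ~~ odd (m * 2)) => [/dvdnP[c]|]; lia.
rewrite odd_step (odd_step 1%N) !muln2.
by case: ifP => _; rewrite ?rmorph1 ?dilate_over_factor //; ring.
Qed.

(** A positive integer not divisible by 2k is odd or is twice one not
    divisible by k. *)
Lemma reg_gf_double k : reg_gf k.*2 = reg_gf 2 * dilate (reg_gf k).
Proof.
apply: fpsP => n; have le_n2n : (n <= n.*2)%N by rewrite -addnn leq_addl.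
rewrite -(reg_prod_stable _ le_n2n) reg_prod_double.
apply: coefsM_eq => i le_in; rewrite ?coefs_dilate reg_prod_stable //; lia.
Qed.

Definition over_gf : fps := reg_gf 0.

Lemma theta_neg_truncE n i : (i <= n)%N -> theta_neg i = theta_neg_trunc n i.
Proof.
move=> le_in; rewrite coefs_qneg !coefsD mulrDr coefs1; congr (_ + _).
  by case: i {le_in} => [|i]; rewrite ?expr0 ?mul1r ?mulr0.
rewrite !coefs_nat mulrCA (coefs_square_series le_in) coefs_sum mulr_sumr; congr (_ * _).
apply: eq_bigr => k _.
have -> : (-1) ^+ k = ((-1) ^+ k)%:~R :> fps by rewrite rmorphXn rmorphN1.
rewrite coefs_int /= [in RHS]eq_sym; case: eqP => [<-|_]; last by rewrite !mulr0.
by rewrite -signr_odd oddX signr_odd.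
Qed.

Lemma theta_neg_low n i : (i <= n)%N -> theta_neg i = inv_prod 1 n i.
Proof.
move=> le_in; rewrite (theta_neg_truncE le_in) finite_gauss coefsD coefs_nat.
rewrite coefs_sum big1_seq ?mulr0 ?addr0 // => s /andP[_].
rewrite mem_index_iota => /andP[s_gt0 _].
have -> : (-1) ^+ s * gauss_tail n s = qpow (s * n.+1) * ((-1) ^+ s * inv_prod s.+1 n * one_plus_inv s).
  by rewrite /gauss_tail; ring.
by rewrite coefs_qpowM leqNgt (_ : (i < s * n.+1)%N) //; nia.
Qed.

(** Modulo q^(n+1) the theta series is the inverse of the partial product. *)
Lemma gauss : theta_neg * over_gf = 1.
Proof.
apply: fpsP => n; rewrite (@coefsM_eq n _ (inv_prod 1 n) _ (reg_prod 0 n)).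
- congr (coefs _ n); rewrite /inv_prod /reg_prod big_seq_cond.
  rewrite [X in _ * X]big_mkcond [X in _ * X]big_seq_cond -big_split /=.
  apply: big1 => i; rewrite mem_index_iota => /andP[/andP[i_gt0 _] _].
  by rewrite dvd0n -lt0n i_gt0 mulrC over_factorV.
- by move=> i le_in; apply: theta_neg_low.
- by move=> i le_in; rewrite reg_prod_stable.
Qed.

(** Half the logarithmic derivative of [over_factor i]. *)
Definition lambert_term (i : nat) : fps := i%:R * qpow i * geometric i.*2.
Definition lambert : fps := Fps (fun n => \sum_(1 <= i < n.+1) lambert_term i n).

Lemma coefs_lambert_term i n :
  lambert_term i n = if (i <= n)%N && (i.*2 %| n - i)%N then i%:R else 0.
Proof.
rewrite /lambert_term -mulrA coefs_nat coefs_qpowM /=.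
by case: leqP; case: dvdn; rewrite ?mulr1 ?mulr0.
Qed.

Lemma euler_over_factor i : (0 < i)%N -> euler (over_factor i) = 2 * lambert_term i * over_factor i.
Proof.
move=> i_gt0; have geo1 := geometricE i_gt0; have pV := one_plus_invE i_gt0.
have gV : (1 + qpow i) * geometric i.*2 = geometric i.
  transitivity (((1 + qpow i) * one_plus_inv i) * geometric i).
    transitivity ((1 - qpow i) * geometric i * ((1 + qpow i) * geometric i.*2)).
      by rewrite geo1 mul1r.
    by rewrite /one_plus_inv; ring.
  by rewrite pV mul1r.
have dgeo : euler (geometric i) = i%:R * qpow i * geometric i ^+ 2.
  have := congr1 euler geo1; rewrite euler1 eulerM raddfB /= euler1 sub0r euler_qpow => d0.
  transitivity (((1 - qpow i) * geometric i) * euler (geometric i)); first by rewrite geo1 mul1r.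
  transitivity (geometric i * ((- (i%:R * qpow i)) * geometric i + (1 - qpow i) * euler (geometric i))
    + i%:R * qpow i * geometric i ^+ 2); first by ring.
  by rewrite d0 mulr0 add0r.
rewrite /over_factor eulerM raddfD /= euler1 add0r euler_qpow dgeo.
transitivity (i%:R * qpow i * geometric i * ((1 - qpow i) * geometric i)
   + (1 + qpow i) * (i%:R * qpow i * geometric i ^+ 2)); first by rewrite geo1 mulr1.
transitivity (2 * (i%:R * qpow i) * geometric i * ((1 + qpow i) * geometric i.*2)).
  by rewrite gV; ring.
by rewrite /lambert_term; ring.
Qed.

Lemma euler_reg_prod m :
  euler (reg_prod 0 m) = 2 * (\sum_(1 <= i < m.+1) lambert_term i) * reg_prod 0 m.
Proof.
elim: m => [|m IH]; first by rewrite reg_prod0 euler1 big_geq // mulr0 mul0r.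
rewrite reg_prodS dvd0n /= eulerM IH euler_over_factor // [in RHS]big_nat_recr //=; ring.
Qed.

Lemma euler_over_gf : euler over_gf = 2 * lambert * over_gf.
Proof.
apply: fpsP => n; rewrite coefs_euler -(reg_prod_stable 0 (leqnn n)) -coefs_euler.
rewrite euler_reg_prod; apply: coefsM_eq => i le_in; last exact: reg_prod_stable.
rewrite !coefs_nat coefs_sum; congr (_ * _).
transitivity (lambert i + \sum_(i.+1 <= j < n.+1) lambert_term j i).
  exact: big_cat_nat.
rewrite big1_seq ?addr0 // => j /andP[_].
by rewrite mem_index_iota => /andP[lt_ij _]; rewrite coefs_lambert_term leqNgt lt_ij.
Qed.

(** * The descent under bisection *)

Section Descent.
Lemma gauss_qneg : theta * qneg over_gf = 1.
Proof. by rewrite -[theta]qnegK -rmorphM /= gauss rmorph1. Qed.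

Lemma dilate_over_gf2 : dilate over_gf ^+ 2 = over_gf * qneg over_gf.
Proof.
have gauss_dil : dilate theta_neg * dilate over_gf = 1.
  by rewrite -rmorphM /= gauss rmorph1.
have := theta_mul_neg; rewrite rmorphXn /= => ab.
transitivity (dilate over_gf ^+ 2 * (theta_neg * over_gf) * (theta * qneg over_gf)).
  by rewrite gauss gauss_qneg !mulr1.
transitivity (dilate over_gf ^+ 2 * (theta * theta_neg) * (over_gf * qneg over_gf)).
  by ring.
rewrite ab; transitivity ((dilate theta_neg * dilate over_gf) ^+ 2 * (over_gf * qneg over_gf)).
  by ring.
by rewrite gauss_dil expr1n mul1r.
Qed.

(** The quotient a / b of the two theta series. *)
Definition theta_quot : fps := theta * over_gf.

Local Notation z := theta_quot.

(** Since z = a / b, this is z + 1/z = (a^2 + b^2) / (a b)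
    = 2 a(q^2)^2 / b(q^2)^2. *)
Lemma theta_quot_quad : z ^+ 2 + 1 = 2 * dilate (z ^+ 2) * z.
Proof.
have -> : dilate (z ^+ 2) = dilate (theta ^+ 2) * dilate over_gf ^+ 2.
  by rewrite exprMn rmorphM !rmorphXn.
rewrite dilate_over_gf2 mulrA -theta2D.
transitivity ((theta ^+ 2 + theta_neg ^+ 2) * over_gf ^+ 2 * (theta * qneg over_gf)).
  transitivity (theta ^+ 2 * over_gf ^+ 2 + (theta_neg * over_gf) ^+ 2).
    by rewrite gauss expr1n /z exprMn.
  by rewrite gauss_qneg; ring.
by rewrite /z; ring.
Qed.

(** As b(q^2)^2 = a b, one has z = a^2 / b(q^2)^2, where only the numerator is
    affected by bisection. *)
Lemma bisect_theta_quot : bisect z = z ^+ 2.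
Proof.
have -> : z = dilate (over_gf ^+ 2) * theta ^+ 2.
  rewrite rmorphXn /= dilate_over_gf2 /z.
  transitivity (theta * over_gf * (theta * qneg over_gf)); last by ring.
  by rewrite gauss_qneg mulr1.
rewrite bisect_dilateM bisect_theta2 rmorphXn /= dilate_over_gf2.
transitivity (over_gf ^+ 2 * theta ^+ 2 * (theta * qneg over_gf) ^+ 2).
  by rewrite gauss_qneg expr1n mulr1.
by ring.
Qed.

Lemma reg_gf2_sqr : reg_gf 2 ^+ 2 = z.
Proof.
have gauss_dil : dilate theta_neg * dilate over_gf = 1.
  by rewrite -rmorphM /= gauss rmorph1.
have regE : reg_gf 2 = over_gf * dilate theta_neg.
  rewrite /over_gf -[0%N in RHS]/(0.*2) reg_gf_double -/over_gf.
  by rewrite -mulrA [dilate over_gf * _]mulrC gauss_dil mulr1.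
rewrite regE exprMn -rmorphXn /= -theta_mul_neg.
transitivity (over_gf * theta * (theta_neg * over_gf)); first by ring.
by rewrite gauss mulr1 mulrC.
Qed.

Lemma reg_gf_pow2_sqr al :
  reg_gf (2 ^ al.+1) ^+ 2 = z * dilate (reg_gf (2 ^ al) ^+ 2).
Proof.
by rewrite expnS mul2n reg_gf_double exprMn reg_gf2_sqr rmorphXn.
Qed.

Lemma reg_gf1 : reg_gf 1 = 1.
Proof.
apply: fpsP => n; rewrite -(reg_prod_stable 1 (leqnn n)) /reg_prod big_pred0 // => i.
by rewrite dvd1n.
Qed.

(** A Chebyshev recurrence: U z^n is the Chebyshev polynomial T_n at z^2. *)
Lemma bisect_pow_rec n : bisect (z ^+ n.+2) = 2 * z ^+ 2 * bisect (z ^+ n.+1) - bisect (z ^+ n).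
Proof.
have -> : z ^+ n.+2 = dilate (2 * z ^+ 2) * z ^+ n.+1 - z ^+ n.
  rewrite rmorphM /= rmorph_nat.
  transitivity (2 * dilate (z ^+ 2) * z * z ^+ n - z ^+ n); last by rewrite (exprS _ n); ring.
  by rewrite -theta_quot_quad (exprS _ n.+1) (exprS _ n); ring.
by rewrite raddfB /= bisect_dilateM.
Qed.

Lemma bisect1 : bisect 1 = 1.
Proof. by apply: fpsP => -[|n]. Qed.

Lemma bisect_pow :
  [/\ bisect (z ^+ 2) = 2 * z ^+ 4 - 1,
      bisect (z ^+ 3) = 4 * z ^+ 6 - 3 * z ^+ 2,
      bisect (z ^+ 4) = 8 * z ^+ 8 - 8 * z ^+ 4 + 1,
      bisect (z ^+ 6) = 32 * z ^+ 12 - 48 * z ^+ 8 + 18 * z ^+ 4 - 1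
    & bisect (z ^+ 7) = 64 * z ^+ 14 - 112 * z ^+ 10 + 56 * z ^+ 6 - 7 * z ^+ 2].
Proof.
have b2 : bisect (z ^+ 2) = 2 * z ^+ 4 - 1.
  by rewrite bisect_pow_rec expr1 expr0 bisect1 bisect_theta_quot; ring.
have b3 : bisect (z ^+ 3) = 4 * z ^+ 6 - 3 * z ^+ 2.
  by rewrite bisect_pow_rec b2 expr1 bisect_theta_quot; ring.
have b4 : bisect (z ^+ 4) = 8 * z ^+ 8 - 8 * z ^+ 4 + 1.
  by rewrite bisect_pow_rec b3 b2; ring.
have b5 := bisect_pow_rec 3; rewrite b4 b3 in b5.
have b6 := bisect_pow_rec 4; rewrite b5 b4 in b6.
have b7 := bisect_pow_rec 5; rewrite b6 b5 in b7.
by split=> //; rewrite ?b6 ?b7; ring.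
Qed.

(** Sixteen times a Hauptmodul of Gamma_0(4). *)
Definition haupt : fps := z ^+ 4 - 1.

Local Notation v := haupt.

(** Squaring z^2 + 1 = 2 R z twice, with R = z(q^2)^2, gives this equation; its
    factor 16 is the source of all the divisibility. *)
Lemma haupt_quad : v ^+ 2 = 16 * dilate (v + v ^+ 2) * (v + 1).
Proof.
have quad := theta_quot_quad; set R := dilate (z ^+ 2) in quad.
have dv : dilate v = R ^+ 2 - 1.
  by rewrite raddfB /= rmorph1 -rmorphXn /= -exprM.
have z4 : z ^+ 4 + 1 = (4 * R ^+ 2 - 2) * z ^+ 2.
  transitivity ((z ^+ 2 + 1) ^+ 2 - 2 * z ^+ 2); first by ring.
  by rewrite quad; ring.
rewrite raddfD /= rmorphXn /= dv.
transitivity ((z ^+ 4 + 1) ^+ 2 - 4 * z ^+ 4); first by rewrite /v; ring.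
by rewrite z4 /v; ring.
Qed.

Definition haupt_poly (p : {poly int}) : fps := (map_poly intr p).[v].

Lemma haupt_polyD p q : haupt_poly (p + q) = haupt_poly p + haupt_poly q.
Proof. by rewrite /haupt_poly rmorphD hornerD. Qed.
Lemma haupt_polyM p q : haupt_poly (p * q) = haupt_poly p * haupt_poly q.
Proof. by rewrite /haupt_poly rmorphM hornerM. Qed.
Lemma haupt_polyX : haupt_poly 'X = v. Proof. by rewrite /haupt_poly map_polyX hornerX. Qed.
Lemma haupt_polyC c : haupt_poly c%:P = c%:~R. Proof. by rewrite /haupt_poly map_polyC hornerC. Qed.

Lemma bisect_int (c : int) f : bisect (c%:~R * f) = c%:~R * bisect f.
Proof. by apply: fpsP => n; rewrite !(coefs_bisect, coefs_int). Qed.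

(** Membership in the Z[v]-module generated by [y]. *)
Definition haupt_multiple (y f : fps) := exists p, f = y * haupt_poly p.

Lemma haupt_multipleD y f g : haupt_multiple y f -> haupt_multiple y g -> haupt_multiple y (f + g).
Proof. by case=> p -> [q ->]; exists (p + q); rewrite haupt_polyD mulrDr. Qed.

Lemma haupt_multipleMl y f p : haupt_multiple y f -> haupt_multiple y (haupt_poly p * f).
Proof. by case=> q ->; exists (p * q); rewrite haupt_polyM mulrCA. Qed.

(** If U x lies in y Z[v] and U (x v) in c y v Z[v], with c a divisor of 16,
    then U (x v f) lies in c y v Z[v] for every f in Z[v]: the quadratic
    equation of v reduces U (x v^(k+2)) to the two preceding powers with a
    factor 16. The first conclusion feeds the induction. *)
Lemma bisect_descent (c c' : int) x y : c * c' = 16 ->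
  haupt_multiple y (bisect x) -> haupt_multiple (c%:~R * y * v) (bisect (x * v)) ->
  forall p, haupt_multiple y (bisect (x * haupt_poly p)) /\ haupt_multiple (c%:~R * y * v) (bisect (x * v * haupt_poly p)).
Proof.
move=> cc' yx yxv; elim/poly_ind => [|p k [IHx IHxv]].
  have -> : haupt_poly 0 = 0 by rewrite /haupt_poly map_poly0 horner0.
  rewrite !mulr0 raddf0; split; exists 0; rewrite /haupt_poly map_poly0 horner0 mulr0 //.
rewrite haupt_polyD haupt_polyM haupt_polyX haupt_polyC.
have linear w : bisect (w * k%:~R) = haupt_poly k%:P * bisect w.
  by rewrite mulrC bisect_int haupt_polyC.
have weaken f : haupt_multiple (c%:~R * y * v) f -> haupt_multiple y f.
  by case=> q ->; exists (c%:P * 'X * q); rewrite !haupt_polyM haupt_polyX haupt_polyC; ring.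
split; rewrite (mulrDr _ (haupt_poly p * v)) raddfD /= linear.
  apply: haupt_multipleD; last exact: haupt_multipleMl.
  by apply: weaken; rewrite mulrA -[x * _ * _]mulrAC.
apply: haupt_multipleD; last exact: haupt_multipleMl.
have -> : x * v * (haupt_poly p * v) = dilate (16 * (v + v ^+ 2)) * (x * v * haupt_poly p + x * haupt_poly p).
  rewrite rmorphM rmorph_nat /=.
  transitivity (16 * dilate (v + v ^+ 2) * (v + 1) * (x * haupt_poly p)); last by ring.
  by rewrite -haupt_quad; ring.
rewrite bisect_dilateM raddfD /=.
have [q ->] : haupt_multiple y (bisect (x * v * haupt_poly p) + bisect (x * haupt_poly p)).
  by apply: haupt_multipleD => //; apply: weaken.
exists (c'%:P * (1 + 'X) * q); rewrite !haupt_polyM haupt_polyD haupt_polyX haupt_polyC.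
have -> : haupt_poly 1 = 1 by rewrite /haupt_poly rmorph1 hornerC.
have -> : 16 = (c * c')%:~R :> fps by rewrite cc'.
by rewrite rmorphM /=; ring.
Qed.

Lemma haupt_poly1 : haupt_poly 1 = 1. Proof. by rewrite /haupt_poly rmorph1 hornerC. Qed.
Lemma haupt_poly_nat n : haupt_poly n%:R = n%:R. Proof. by rewrite /haupt_poly rmorph_nat -(rmorph_nat polyC) hornerC. Qed.

Lemma bisect_nat (k : nat) f : bisect (k%:R * f) = k%:R * bisect f.
Proof. by rewrite !mulr_natl raddfMn. Qed.

(** The shape kept while bisection strips the factors z(q^(2^i)) of the
    generating series one by one. *)
Definition weighted_form f := exists p, f = z ^+ 2 * (1 + 4 * v * haupt_poly p).

Lemma weighted_form_step f :
  weighted_form f -> weighted_form (bisect (z * f)).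
Proof.
have [b2 b3 b4 b6 b7] := bisect_pow.
case=> p ->.
have [||_ [q bq]] := @bisect_descent 4 4 (z ^+ 3) (z ^+ 2) (erefl _) _ _ p.
- exists (1 + 4 * 'X); rewrite haupt_polyD haupt_polyM haupt_poly1 haupt_poly_nat haupt_polyX b3 /v; ring.
- exists (16 * 'X ^+ 2 + 20 * 'X + 5).
  have -> : z ^+ 3 * v = z ^+ 7 - z ^+ 3 by rewrite /v; ring.
  by rewrite raddfB /= b7 b3 !(haupt_polyD, haupt_polyM, haupt_poly_nat, haupt_polyX) -[4%:~R]/(4%:R) /v; ring.
exists (1 + 4 * q).
have -> : z * (z ^+ 2 * (1 + 4 * v * haupt_poly p)) = z ^+ 3 + 4 * (z ^+ 3 * v * haupt_poly p) by ring.
rewrite raddfD /= bisect_nat bq b3 haupt_polyD haupt_polyM haupt_poly1 haupt_poly_nat -[4%:~R]/(4%:R) /v; ring.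
Qed.

(** Each bisection consumes one factor z of the product, as
    U (g z(q) h(q^2)) = U (g z) h. *)
Lemma weighted_form_iter al g : weighted_form g ->
  weighted_form (iter al bisect (g * reg_gf (2 ^ al) ^+ 2)).
Proof.
elim: al g => [|al IH] g gform; first by rewrite reg_gf1 expr1n mulr1.
rewrite iterSr reg_gf_pow2_sqr mulrCA mulrA mulrC bisect_dilateM mulrC.
by apply: IH; apply: weighted_form_step.
Qed.

Lemma iter_bisect_reg_gf al : exists p,
  iter al.+2 bisect (reg_gf (2 ^ al.+1) ^+ 2) = 1 + 2 * v + 64 * v * haupt_poly p.
Proof.
have [b2 b3 b4 b6 b7] := bisect_pow.
rewrite iterS iterSr reg_gf_pow2_sqr mulrC bisect_dilateM bisect_theta_quot mulrC.
have [|p ->] := @weighted_form_iter al (z ^+ 2).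
  by exists 0; rewrite /haupt_poly map_poly0 horner0 mulr0 addr0 mulr1.
have [||_ [q bq]] := @bisect_descent 16 1 (z ^+ 2) 1 (erefl _) _ _ p.
- exists (1 + 2 * 'X); rewrite haupt_polyD haupt_polyM haupt_poly1 haupt_poly_nat haupt_polyX b2 /v; ring.
- exists ((1 + 'X) * (1 + 2 * 'X)).
  have -> : z ^+ 2 * v = z ^+ 6 - z ^+ 2 by rewrite /v; ring.
  rewrite raddfB /= b6 b2 !(haupt_polyD, haupt_polyM, haupt_poly1, haupt_poly_nat, haupt_polyX) -[16%:~R]/(16%:R) /v; ring.
exists q.
have -> : z ^+ 2 * (1 + 4 * v * haupt_poly p) = z ^+ 2 + 4 * (z ^+ 2 * v * haupt_poly p) by ring.
rewrite raddfD /= bisect_nat bq b2 -[16%:~R]/(16%:R) /v; ring.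
Qed.

Lemma bisect_haupt : bisect v = 8 * (v + v ^+ 2).
Proof.
have [b2 b3 b4 b6 b7] := bisect_pow.
by rewrite /v raddfB /= b4 bisect1; ring.
Qed.

Lemma bisect_haupt2 : bisect (v ^+ 2) = 16 * (v + v ^+ 2) * (1 + 8 * (v + v ^+ 2)).
Proof.
rewrite {1}haupt_quad.
have -> : 16 * dilate (v + v ^+ 2) * (v + 1) = dilate (16 * (v + v ^+ 2)) * (v + 1).
  by rewrite rmorphM rmorph_nat.
by rewrite bisect_dilateM raddfD /= bisect_haupt bisect1; ring.
Qed.

(** The shape kept by every further bisection, [b] of them giving 8^b. The
    terms in v and v^2 have coefficients that later matter modulo 256 only,
    whereas the coefficients of 16 v f(v) are already divisible by 256. *)
Definition valuation_form b f := exists (c d : int) p,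
  f = 1 + 2 * 8 ^+ b * (c%:~R * v + d%:~R * v ^+ 2 + 16 * v * haupt_poly p).

Lemma valuation_form_step b f : valuation_form b f -> valuation_form b.+1 (bisect f).
Proof.
case=> c [d [p ->]].
have [||_ [q]] := @bisect_descent 8 2 1 1 (erefl _) _ _ p.
- by exists 1; rewrite bisect1 haupt_poly1 mulr1.
- exists (1 + 'X); rewrite mul1r bisect_haupt haupt_polyD haupt_poly1 haupt_polyX -[8%:~R]/(8%:R); ring.
rewrite !mul1r -[8%:~R]/(8%:R) mulr1 => bq.
(* Both v and v^2 contribute to v + v^2; the rest of U (v^2) is
   8 d 16 (v + v^2)^2, which joins the last term. *)
exists (c + 2 * d), (c + 2 * d), (q + d%:P * 'X * (1 + 'X) ^+ 2).
rewrite raddfD /= bisect1; congr (1 + _).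
have KE : 2 * 8 ^+ b = (2 * 8 ^+ b : int)%:~R :> fps.
  by rewrite rmorphM rmorphXn.
rewrite KE bisect_int -KE !raddfD /= !bisect_int bisect_haupt bisect_haupt2.
rewrite -[16 * v * haupt_poly p]mulrA bisect_nat bq.
rewrite (expr2 (1 + 'X)) !(haupt_polyD, haupt_polyM, haupt_poly1, haupt_poly_nat, haupt_polyX, haupt_polyC).
rewrite !rmorphM /= (exprS 8); ring.
Qed.

Lemma valuation_form_iter al b :
  valuation_form b (iter (al + b).+2 bisect (reg_gf (2 ^ al.+1) ^+ 2)).
Proof.
elim: b => [|b IH]; last by rewrite addnS iterS; apply: valuation_form_step.
rewrite addn0; have [p ->] := iter_bisect_reg_gf al.
exists 1, 0, (2 * p); rewrite haupt_polyM haupt_poly_nat expr0; ring.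
Qed.

Lemma coefs_iter_bisect k f n : iter k bisect f n = f (2 ^ k * n)%N.
Proof.
elim: k n => [|k IH] n; first by rewrite mul1n.
by rewrite iterS coefs_bisect IH expnSr -mulnA mul2n.
Qed.

End Descent.

(** * Logarithmic derivatives and the four-square identity *)

Section LogDerivative.

Local Notation z := theta_quot.
Local Notation v := haupt.
Local Notation a := theta.
Local Notation b := theta_neg.

Definition dlog_neg : fps := - (2 * lambert).
Definition dlog : fps := qneg dlog_neg.

Local Notation h := dlog_neg.
Local Notation g := dlog.

Lemma euler_theta_neg : euler b = h * b.
Proof.
have := congr1 euler gauss; rewrite eulerM euler1 euler_over_gf => d0.
transitivity (b * (euler b * over_gf + b * (2 * lambert * over_gf))
  - 2 * lambert * b * (b * over_gf)
  + euler b * (1 - b * over_gf)); first by ring.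
by rewrite d0 gauss /h; ring.
Qed.

Lemma euler_theta : euler a = g * a.
Proof. by rewrite -[a]qnegK euler_qneg euler_theta_neg rmorphM /= qnegK. Qed.

Lemma euler_nat (k : nat) f : euler (k%:R * f) = k%:R * euler f.
Proof. by rewrite !mulr_natl raddfMn. Qed.

Lemma euler_sqr f k : euler f = k * f -> euler (f ^+ 2) = 2 * k * f ^+ 2.
Proof. by move=> df; rewrite expr2 eulerM df; ring. Qed.

Lemma euler_dilate_log f k : euler f = k * f -> euler (dilate f) = 2 * dilate k * dilate f.
Proof. by move=> df; rewrite euler_dilate df rmorphM mulrA. Qed.

(** Logarithmic derivative of 2 a(q^2)^2 = a^2 + b^2. *)
Lemma dlog_dilate_theta : 2 * dilate g * (a ^+ 2 + b ^+ 2) = g * a ^+ 2 + h * b ^+ 2.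
Proof.
apply: mul2fI.
transitivity (euler (2 * dilate a ^+ 2)).
  rewrite euler_nat (euler_sqr (euler_dilate_log euler_theta)) theta2D rmorphXn /=; ring.
rewrite -rmorphXn /= -theta2D raddfD /= (euler_sqr euler_theta) (euler_sqr euler_theta_neg).
by ring.
Qed.

(** Logarithmic derivative of b(q^2)^2 = a b. *)
Lemma dlog_dilate_theta_neg : 4 * dilate h = g + h.
Proof.
have : euler (a * b) = euler (dilate b ^+ 2) by rewrite theta_mul_neg rmorphXn.
rewrite eulerM euler_theta euler_theta_neg (euler_sqr (euler_dilate_log euler_theta_neg)).
rewrite -[dilate b ^+ 2]rmorphXn /= -theta_mul_neg => eq_dlog.
have inv : a * b * (over_gf * qneg over_gf) = 1.
  transitivity ((b * over_gf) * (a * qneg over_gf)); first by ring.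
  by rewrite gauss gauss_qneg mulr1.
transitivity (2 * (2 * dilate h) * (a * b) * (over_gf * qneg over_gf)).
  by rewrite -mulrA inv; ring.
rewrite -eq_dlog -[RHS]mulr1 -inv; ring.
Qed.

(** Its vanishing is Jacobi's four-square theorem at odd integers. *)
Definition four_defect : fps := 4 * (g - h) - (a ^+ 4 - b ^+ 4).

(** The derivatives of the two theta identities express E(q^2) through E(q);
    on the other side, 4 (a^4 - b^4)(q^2) = (a^2 - b^2)^2. *)
Lemma four_defect_dilate : 4 * (a ^+ 2 + b ^+ 2) * dilate four_defect =
  (a ^+ 2 - b ^+ 2) * four_defect.
Proof.
have dil4 : 4 * dilate (a ^+ 4 - b ^+ 4) = (a ^+ 2 - b ^+ 2) ^+ 2.
  rewrite raddfB /= -![_ ^+ 4]/(_ ^+ (2 * 2)) !exprM rmorphXn /=.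
  rewrite [dilate ((b ^+ 2) ^+ 2)]rmorphXn /= -theta_mul_neg.
  transitivity ((2 * dilate (a ^+ 2)) ^+ 2 - 4 * (a * b) ^+ 2); first by ring.
  by rewrite -theta2D; ring.
rewrite /four_defect raddfB /= rmorphM rmorph_nat raddfB /=.
transitivity (8 * (2 * dilate g * (a ^+ 2 + b ^+ 2))
  - 4 * (4 * dilate h) * (a ^+ 2 + b ^+ 2)
  - (a ^+ 2 + b ^+ 2) * (4 * dilate (a ^+ 4 - b ^+ 4))).
  rewrite raddfB /=; ring.
by rewrite dlog_dilate_theta dlog_dilate_theta_neg dil4; ring.
Qed.

Lemma theta_coefs01 : (a 0%N = 1) /\ (a 1%N = 2).
Proof.
split; rewrite coefsD coefs_nat coefs1 (coefs_square_series (leqnn _)).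
  by rewrite big_geq.
by rewrite big_nat1.
Qed.

Lemma coefsM1 f (k : fps) : (f * k) 1%N = f 0%N * k 1%N + f 1%N * k 0%N.
Proof. by rewrite coefsM !big_ord_recl big_ord0 addr0. Qed.

Lemma coefs_pow4 f : (f ^+ 4) 0%N = (f ^+ 2) 0%N * (f ^+ 2) 0%N /\
  (f ^+ 4) 1%N = 2 * (f ^+ 2) 0%N * (f ^+ 2) 1%N.
Proof.
have -> : f ^+ 4 = f ^+ 2 * f ^+ 2 by ring.
by move: (f ^+ 2) => k; split; rewrite ?coefsM0 // coefsM1; ring.
Qed.

Lemma coefsM_low f (k : fps) n : f 0%N = 0 -> (forall i, (i < n)%N -> k i = 0) ->
  (f * k) n.+1 = f 1%N * k n.
Proof.
move=> f0 k0; rewrite coefsM !big_ord_recl f0 mul0r add0r /= subn1 big1 ?addr0 //.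
move=> i _; rewrite k0 ?mulr0 //; have := ltn_ord i; rewrite /= /bump /=; lia.
Qed.

Lemma theta2_coefs01 : ((a ^+ 2) 0%N = 1) /\ ((a ^+ 2) 1%N = 4).
Proof.
have [a0 a1] := theta_coefs01; rewrite expr2 coefsM0 a0; split=> //.
by rewrite coefsM1 a0 a1.
Qed.

Lemma lambert_coefs01 : (lambert 0%N = 0) /\ (lambert 1%N = 1).
Proof.
split; first by rewrite [LHS]big_geq.
by rewrite [LHS]big_nat1 coefs_lambert_term.
Qed.

(** If E has order n >= 2, the left side of [four_defect_dilate] has order 2n
    and the right side, where a^2 - b^2 = 8 q + ..., has order n + 1 < 2n. The
    coefficients of index 0 and 1 are checked directly. *)
Lemma four_defect_eq0 : four_defect = 0.
Proof.
have [a0 a1] := theta2_coefs01; have [l0 l1] := lambert_coefs01.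
have b0 : (b ^+ 2) 0%N = 1 by rewrite theta_neg2 coefs_qneg a0.
have b1 : (b ^+ 2) 1%N = - 4 by rewrite theta_neg2 coefs_qneg a1.
have h0 : h 0%N = 0 by rewrite coefsN coefs_nat l0.
have h1 : h 1%N = - 2 by rewrite coefsN coefs_nat l1.
have E0 : four_defect 0%N = 0.
  rewrite coefsB coefs_nat !coefsB [g _]coefs_qneg h0.
  by rewrite (proj1 (coefs_pow4 a)) (proj1 (coefs_pow4 b)) a0 b0.
have E1 : four_defect 1%N = 0.
  rewrite coefsB coefs_nat !coefsB [g _]coefs_qneg h1.
  by rewrite (proj2 (coefs_pow4 a)) (proj2 (coefs_pow4 b)) a0 b0 a1 b1.
apply: fpsP => n; rewrite coefs0; elim/ltn_ind: n => -[|[|n]] // IH.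
set E := four_defect in IH *.
(* Here E_i = 0 for i < n + 2, and the coefficient of index n + 3 isolates
   8 E_(n + 2) on the other side. *)
have : (4 * (a ^+ 2 + b ^+ 2) * dilate E) n.+3 = 0.
  rewrite coefsM big1 // => i _; rewrite coefs_dilate.
  case: ifP => _; rewrite ?IH ?mulr0 //; lia.
rewrite four_defect_dilate -/E coefsM_low ?coefsB ?a0 ?b0 ?subrr //.
by rewrite a1 b1; lia.
Qed.

Definition odd_lambert : fps := Fps (fun n => if odd n then lambert n else 0).

Local Notation O := odd_lambert.

Lemma coefs_odd_lambert n : O n = if odd n then lambert n else 0.
Proof. by []. Qed.

Lemma dlogB : g - h = 4 * O.
Proof.
apply: fpsP => n; rewrite coefsB coefs_nat [g n]coefs_qneg coefsN coefs_nat.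
rewrite coefs_odd_lambert -signr_odd.
by case: odd; rewrite ?expr1 ?expr0; lia.
Qed.

Lemma theta4B : a ^+ 4 - b ^+ 4 = 16 * O.
Proof.
have := four_defect_eq0; rewrite /four_defect dlogB => /eqP.
by rewrite subr_eq0 => /eqP <-; ring.
Qed.

(** The Hauptmodul q + ..., an integral series equal to v / 16. *)
Definition haupt16 : fps := O * over_gf ^+ 4.

Local Notation w := haupt16.

Lemma haupt16_theta_neg : w * b ^+ 4 = O.
Proof.
transitivity (O * (b * over_gf) ^+ 4); first by rewrite /w; ring.
by rewrite gauss expr1n mulr1.
Qed.

Lemma hauptE : v = 16 * w.
Proof.
rewrite /w mulrA -theta4B /v /z.
transitivity (a ^+ 4 * over_gf ^+ 4 - (b * over_gf) ^+ 4); last by ring.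
by rewrite gauss expr1n exprMn.
Qed.

(** Logarithmic differentiation of a^4 - b^4 = 16 O. *)
Lemma odd_lambert_euler : O * (a ^+ 4 + b ^+ 4) = 2 * euler O + 32 * dilate lambert * O.
Proof.
have gh : g = 2 * O + 2 * dilate h.
  apply: mul2fI; transitivity ((g - h) + (g + h)); first by ring.
  by rewrite dlogB -dlog_dilate_theta_neg; ring.
have hg : h = g - 4 * O by rewrite -dlogB; ring.
have d4 f k : euler f = k * f -> euler (f ^+ 4) = 4 * k * f ^+ 4.
  move=> df; rewrite -[_ ^+ 4]/(_ ^+ (2 * 2)) exprM.
  by rewrite (euler_sqr (euler_sqr df)) -exprM; ring.
have d16 := congr1 euler theta4B.
rewrite euler_nat raddfB /= (d4 _ _ euler_theta) (d4 _ _ euler_theta_neg) in d16.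
have dh : dilate h = - (2 * dilate lambert) by rewrite raddfN /= rmorphM rmorph_nat.
rewrite {1}hg gh dh in d16.
do 3 apply: mul2fI.
transitivity (4 * (2 * O + 2 * - (2 * dilate lambert)) * a ^+ 4 -
 4 * (2 * O + 2 * - (2 * dilate lambert) - 4 * O) * b ^+ 4
 + 16 * dilate lambert * (a ^+ 4 - b ^+ 4)); first by ring.
by rewrite d16 theta4B; ring.
Qed.

Lemma qneg_odd_lambert : qneg O = - O.
Proof.
apply: fpsP => n; rewrite coefs_qneg coefsN -signr_odd /=.
by case: odd; rewrite ?expr1 ?expr0 ?mulN1r ?mulr0 ?oppr0.
Qed.

(** The part of w of odd index times a^4 b^4 = b(q^2)^8 is D O + 16 (...), and
    b^8 = (1 + 2 s)^8 is 1 modulo 16. *)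
Lemma haupt16_odd n : odd n -> exists t : int, w n = n%:R * lambert n + 16 * t.
Proof.
move=> odd_n.
have [X thetaX] : exists X, a ^+ 4 * b ^+ 4 = 1 + 16 * X.
  pose s := qneg square_series.
  have bE : b = 1 + 2 * s by rewrite /b /a rmorphD rmorph1 rmorphM rmorph_nat.
  (* The nontrivial part of (1 + 2 s)^8, divided by 16. *)
  exists (dilate (s + 7 * s ^+ 2 + 28 * s ^+ 3 + 70 * s ^+ 4 + 112 * s ^+ 5 +
    112 * s ^+ 6 + 64 * s ^+ 7 + 16 * s ^+ 8)).
  rewrite -exprMn theta_mul_neg -rmorphXn /= bE -(rmorph_nat dilate 16) -rmorphM /=.
  rewrite -(rmorph1 dilate) -rmorphD /=; congr dilate.
  rewrite -exprM; ring.
(* [w - dilate (bisect w)] is the odd part of w, that is, half of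
   [w - qneg w]. *)
have key : (w - dilate (bisect w)) * (1 + 16 * X) = euler O + 16 * dilate lambert * O.
  apply: mul2fI; rewrite -thetaX.
  transitivity ((w - qneg w) * (a ^+ 4 * b ^+ 4)).
    have -> : qneg w = 2 * dilate (bisect w) - w by rewrite -addr_qneg; ring.
    by ring.
  have sw : qneg w * a ^+ 4 = - O.
    by rewrite -qneg_odd_lambert -haupt16_theta_neg (rmorphM _ w) rmorphXn /= qnegK.
  transitivity ((w * b ^+ 4) * a ^+ 4 - (qneg w * a ^+ 4) * b ^+ 4); first by ring.
  rewrite sw haupt16_theta_neg.
  transitivity (O * (a ^+ 4 + b ^+ 4)); first by ring.
  by rewrite odd_lambert_euler; ring.
exists ((dilate lambert * O - (w - dilate (bisect w)) * X) n).
have -> : n%:R * lambert n = euler O n by rewrite coefs_euler /= odd_n.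
rewrite -coefs_nat -coefsD.
transitivity ((w - dilate (bisect w)) n).
  by rewrite coefsB coefs_dilate odd_n subr0.
congr (coefs _ n).
transitivity ((w - dilate (bisect w)) * (1 + 16 * X) - 16 * ((w - dilate (bisect w)) * X)).
  by ring.
by rewrite key; ring.
Qed.

Lemma haupt16_double n : w n.*2 = 8 * w n + 128 * (w ^+ 2) n.
Proof.
have : (bisect v) n = (8 * (v + v ^+ 2)) n by rewrite bisect_haupt.
rewrite coefs_bisect hauptE !(coefs_nat, coefsD).
have -> : (16 * w) ^+ 2 = 256 * w ^+ 2 by ring.
rewrite coefs_nat; lia.
Qed.

Lemma haupt16_dvd n m : odd n -> (16 %| lambert n)%Z -> (16 %| w (2 ^ m * n)%N)%Z.
Proof.
move=> odd_n lam16; elim: m => [|m IH].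
  rewrite mul1n; have [t ->] := haupt16_odd odd_n.
  by apply: rpredD; [apply: dvdz_mull | apply: dvdz_mulr].
rewrite expnS -mulnA mul2n haupt16_double.
by apply: rpredD; [apply: dvdz_mull | apply: dvdz_mulr].
Qed.

End LogDerivative.

(** * Divisor sums *)

Definition sigma (n : nat) : nat := \sum_(d <- divisors n) d.

Lemma lambert_odd n : odd n -> lambert n = (sigma n)%:Z.
Proof.
move=> odd_n; have n_gt0 : (0 < n)%N by case: n odd_n.
transitivity (\sum_(1 <= i < n.+1 | (i %| n)%N) i)%N%:Z.
  rewrite -[RHS]natz natr_sum [RHS]big_mkcond; apply: eq_big_nat => i /andP[i_gt0 lt_in].
  rewrite coefs_lambert_term -ltnS lt_in /=; congr (if _ then _ else _).
  apply/idP/idP => [dvd_2i|/dvdnP[c nE]].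
    rewrite -(subnK (lt_in : (i <= n)%N)) dvdn_addl //.
    by apply: dvdn_trans dvd_2i; rewrite -muln2 dvdn_mulr.
  move: odd_n; rewrite nE oddM => /andP[odd_c _].
  have -> : (c * i - i = c./2 * i.*2)%N.
    by rewrite -{1}(odd_double_half c) odd_c; lia.
  by rewrite dvdn_mull.
congr Posz; rewrite -big_filter; apply: perm_big; apply: uniq_perm.
- by rewrite filter_uniq ?iota_uniq.
- exact: divisors_uniq.
move=> d; rewrite mem_filter mem_index_iota -dvdn_divisors //.
case: (boolP (d %| n)%N) => //= dvd_dn.
by rewrite ltnS (dvdn_gt0 n_gt0 dvd_dn) dvdn_leq.
Qed.

Lemma sigma_pfactor p e m : prime p -> (0 < m)%N -> ~~ (p %| m)%N ->
  sigma (p ^ e * m) = ((\sum_(i < e.+1) p ^ i) * sigma m)%N.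
Proof.
move=> p_pr m_gt0 p'm; have p_gt0 := prime_gt0 p_pr.
have log0 d : (d %| m)%N -> logn p d = 0%N.
  move=> dvd_dm; have d_gt0 := dvdn_gt0 m_gt0 dvd_dm.
  apply/eqP; rewrite -leqn0 -ltnS ltnNge.
  apply: contra p'm => log_gt0; apply: dvdn_trans dvd_dm.
  by rewrite -[p]expn1 pfactor_dvdn.
pose s := [seq (p ^ i * d)%N | i <- iota 0 e.+1, d <- divisors m].
have s_divisors : perm_eq (divisors (p ^ e * m)) s.
  apply: uniq_perm; rewrite ?divisors_uniq //.
    apply: allpairs_uniq; rewrite ?iota_uniq ?divisors_uniq //.
    move=> x y x_s y_s eq_xy.
    have [[i d] /= [_ dvd_d xE]] := allpairsP x_s.
    have [[i' d'] /= [_ dvd_d' yE]] := allpairsP y_s.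
    move: eq_xy; rewrite {}xE {}yE /= => eq_id.
    rewrite -!dvdn_divisors // in dvd_d dvd_d'.
    have eq_i : i = i'.
      have := congr1 (logn p) eq_id.
      by rewrite !lognM ?expn_gt0 ?p_gt0 ?(dvdn_gt0 m_gt0) // !pfactorK // !log0 // !addn0.
    by move: eq_id; rewrite eq_i => /eqP; rewrite eqn_pmul2l ?expn_gt0 ?p_gt0 // => /eqP ->.
  move=> x; rewrite -dvdn_divisors ?muln_gt0 ?expn_gt0 ?p_gt0 //.
  apply/idP/allpairsP => [dvd_x | [[i d] []]]; last first.
    rewrite mem_iota -dvdn_divisors //= => le_ie dvd_d ->.
    by rewrite dvdn_mul // dvdn_exp2l.
  have pm_gt0 : (0 < p ^ e * m)%N by rewrite muln_gt0 expn_gt0 p_gt0.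
  have x_gt0 := dvdn_gt0 pm_gt0 dvd_x.
  have [d cop_pd xE] := pfactor_coprime p_pr x_gt0.
  exists (logn p x, d); split; last by rewrite [RHS]mulnC.
    rewrite mem_iota /= add0n ltnS.
    have := dvdn_leq_log p pm_gt0 dvd_x.
    by rewrite lognM ?expn_gt0 ?p_gt0 // pfactorK // (log0 m) // addn0.
  rewrite -dvdn_divisors // -(@Gauss_dvdr _ (p ^ e)); last first.
    by rewrite coprimeXr // coprime_sym.
  by apply: dvdn_trans dvd_x; rewrite [in X in (_ %| X)%N]xE dvdn_mulr.
rewrite /sigma (perm_big _ s_divisors) /= /s big_allpairs_dep big_distrl /=.
rewrite -(big_mkord xpredT (fun i => p ^ i * _)%N) /index_iota subn0.
by apply: eq_bigr => i _; rewrite big_distrr.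
Qed.

(** The sum is (1 + p) (1 + p^(2c)) (1 + p^(4c)) ... times an integer: the first
    factor contributes 2^j and each of the k others is even. *)
Lemma sum_pow_dvd p j k c : (0 < j)%N -> (2 ^ j %| p.+1)%N ->
  (2 ^ (j + k) %| \sum_(i < 2 ^ k.+1 * c) p ^ i)%N.
Proof.
move=> j_gt0 dvd_p; have odd_p : odd p.
  have : (2 %| p.+1)%N by apply: dvdn_trans dvd_p; rewrite -{1}[2%N]expn1 dvdn_exp2l.
  by rewrite dvdn2 /= negbK.
elim: k => [|k IH].
  rewrite addn0 expn1.
  suff -> : (\sum_(i < 2 * c) p ^ i = p.+1 * \sum_(i < c) p ^ (2 * i))%N.
    exact: dvdn_mulr.
  elim: c => [|c IH]; first by rewrite muln0 !big_ord0 muln0.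
  by rewrite mulnS /= !big_ord_recr /= IH mulnDr expnS -addnA mulSn.
have -> : (\sum_(i < 2 ^ k.+2 * c) p ^ i =
    (\sum_(i < 2 ^ k.+1 * c) p ^ i) * (p ^ (2 ^ k.+1 * c)).+1)%N.
  rewrite expnS -mulnA mul2n -addnn; move: (2 ^ k.+1 * c)%N => M.
  rewrite big_split_ord /= mulnS; congr (_ + _)%N; rewrite big_distrl /=.
  by apply: eq_bigr => i _; rewrite expnD mulnC.
rewrite addnS expnSr dvdn_mul // dvdn2 /= negbK oddX odd_p orbT //.
Qed.

Lemma sigma_dvd16 n j p : (1 <= j)%N -> (j < 5)%N -> prime p -> odd n ->
  (2 ^ j %| p.+1)%N -> (2 ^ (5 - j) %| (logn p n).+1)%N -> (16 %| sigma n)%N.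
Proof.
move=> j1 j5 p_pr odd_n dvd_p /dvdnP[c logE].
have n_gt0 : (0 < n)%N by case: n odd_n {logE}.
have [m cop_pm ->] := pfactor_coprime p_pr n_gt0.
have m_gt0 : (0 < m)%N.
  by case: m cop_pm => //; rewrite /coprime gcdn0 => /eqP p1; rewrite p1 in p_pr.
rewrite mulnC sigma_pfactor // -?prime_coprime // dvdn_mulr // logE mulnC.
have -> : (16 = 2 ^ (j + (4 - j)))%N by rewrite subnKC // -ltnS.
by have -> : (5 - j = (4 - j).+1)%N; [lia | apply: sum_pow_dvd].
Qed.

(** * Counting overpartitions *)

(** The path starting at a virtual plain part m bounds all parts by m, while a
    virtual overlined part would bound them by m - 1. *)
Definition bounded_regular (k m n : nat) (s : seq part) : bool :=
  [&& path may_precede (m, false) s, all (fun x => 0 < x.1)%N s, regular k s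
    & weight s == n].

Lemma weight_cons x s : weight (x :: s) = (x.1 + weight s)%N.
Proof. by rewrite /weight big_cons. Qed.

Lemma path_may_precede_true m s :
  path may_precede (m.+1, true) s = path may_precede (m, false) s.
Proof.
by case: s => //= y s; congr (_ && _); rewrite /may_precede /= andbF orbF andbT; lia.
Qed.

Lemma may_precede_step m (x : part) : x.1 != m.+1 ->
  may_precede (m.+1, false) x = may_precede (m, false) x.
Proof. by case: x => i b /=; rewrite /may_precede /=; lia. Qed.

Lemma bounded_regular_cons k m n x s :
  bounded_regular k m n (x :: s) = [&& may_precede (m, false) x, (0 < x.1)%N,
    ~~ (k %| x.1)%N, (x.1 <= n)%N, path may_precede x s,
    all (fun x => 0 < x.1)%N s, regular k s & weight s == (n - x.1)%N].
Proof.
rewrite /bounded_regular weight_cons /=.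
have -> : (x.1 + weight s == n)%N = (x.1 <= n)%N && (weight s == n - x.1)%N by lia.
case: may_precede; case: (path _ x s); case: (0 < x.1)%N; case: (all _ s);
  case: (k %| x.1)%N; case: (regular k s); case: (x.1 <= n)%N => //=.
Qed.

(** The recurrence (1 - q^m) F_m = (1 + q^m) F_(m-1). Its three terms match the
    overpartitions that start below m, with an overlined m, and with a plain
    m. *)
Lemma reg_prod_rec k m n : ~~ (k %| m.+1)%N -> reg_prod k m.+1 n =
  reg_prod k m n + if (m.+1 <= n)%N
    then reg_prod k m (n - m.+1)%N + reg_prod k m.+1 (n - m.+1)%N else 0.
Proof.
move=> /negPf k'm.
have recE : reg_prod k m.+1 =
    reg_prod k m + qpow m.+1 * (reg_prod k m + reg_prod k m.+1).
  rewrite reg_prodS k'm /over_factor.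
  transitivity (((1 - qpow m.+1) * geometric m.+1) * reg_prod k m * (1 + qpow m.+1)
     + qpow m.+1 * (1 + qpow m.+1) * geometric m.+1 * reg_prod k m); first by ring.
  by rewrite geometricE //; ring.
by rewrite {1}recE coefsD coefs_qpowM.
Qed.

(** Induction on the bound m, then on the weight n, by the first part. *)
Lemma bounded_regular_listing k m n :
  {l : seq (seq part) | [/\ uniq l, forall s, (s \in l) = bounded_regular k m n s
     & (size l)%:Z = reg_prod k m n]}.
Proof.
elim: m n => [|m IHm] n.
  exists (nseq (n == 0%N) [::]); split; first by case: eqP.
    move=> [|x s]; rewrite mem_nseq.
      by rewrite /bounded_regular /weight big_nil /= eqxx andbT eq_sym; case: eqP.
    rewrite bounded_regular_cons /may_precede /= andbT.
    by case: (x.1); rewrite !andbF.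
  by rewrite reg_prod0 coefs1 size_nseq; case: eqP.
have [k_m|k'm] := boolP (k %| m.+1)%N.
  have [l [uniq_l mem_l size_l]] := IHm n; exists l; split=> //.
    move=> s; rewrite mem_l; case: s => // x s.
    rewrite !bounded_regular_cons; case k'x: (k %| x.1)%N; rewrite ?andbF //=.
    by rewrite may_precede_step //; apply: contraFneq k'x => ->.
  by rewrite reg_prodS k_m mul1r.
elim/ltn_ind: n => n IHn.
have [l1 [uniq1 mem1 size1]] := IHm n.
have [lt_nm|le_mn] := ltnP n m.+1.
  exists l1; split=> //; last by rewrite reg_prod_rec // leqNgt lt_nm addr0.
  move=> s; rewrite mem1; case: s => // x s.
  rewrite !bounded_regular_cons.
  case: (leqP x.1 n) => [le_xn|]; rewrite ?andbF //=.
  by rewrite may_precede_step // neq_ltn (leq_ltn_trans le_xn lt_nm).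
have [l2 [uniq2 mem2 size2]] := IHm (n - m.+1)%N.
have lt_n : (n - m.+1 < n)%N by lia.
have [l3 [uniq3 mem3 size3]] := IHn _ lt_n.
exists (l1 ++ [seq (m.+1, true) :: s | s <- l2] ++ [seq (m.+1, false) :: s | s <- l3]).
have memT x s b l : ((x :: s) \in [seq (m.+1, b) :: t | t <- l]) =
    (x == (m.+1, b)) && (s \in l).
  apply/mapP/andP => [[t t_l [-> ->]]|[/eqP -> s_l]]; first by rewrite eqxx.
  by exists s.
have memN b l : ([::] \in [seq (m.+1, b) :: t | t <- l]) = false.
  by apply/mapP => -[].
have head1 b s : ((m.+1, b) :: s \in l1) = false.
  by rewrite mem1 bounded_regular_cons /may_precede /= andbT; lia.
split.
- rewrite !cat_uniq uniq1 !map_inj_uniq ?uniq2 ?uniq3; try by move=> ? ? [].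
  rewrite andbT /=; apply/andP; split; apply/hasPn => -[|x s].
  + by rewrite mem_cat !memN.
  + by rewrite mem_cat !memT => /orP[] /andP[/eqP -> _]; rewrite /= head1.
  + by rewrite memN.
  + by rewrite !memT => /andP[/eqP -> _]; rewrite xpair_eqE andbF.
- move=> s; rewrite !mem_cat; case: s => [|x s].
    by rewrite !memN mem1 !orbF.
  rewrite !memT mem1 mem2 mem3 !bounded_regular_cons.
  rewrite /bounded_regular.
  case: x => i b; rewrite !xpair_eqE /=.
  have [->|neq_i] := eqVneq i m.+1; last first.
    by rewrite !orbF may_precede_step.
  rewrite k'm le_mn /may_precede /= eqxx ltnn ltnNge leqnSn /= andbT.
  rewrite (_ : (m.+1 == m)%N = false) /=; last by lia.
  by case: b => /=; rewrite ?path_may_precede_true ?orbF.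
- by rewrite !size_cat !size_map !PoszD size1 size2 size3 [in RHS]reg_prod_rec // le_mn.
Qed.

Lemma part_le_weight (s : seq part) x : x \in s -> (x.1 <= weight s)%N.
Proof.
elim: s => // y s IH; rewrite inE weight_cons => /orP[/eqP ->|/IH le_x].
  exact: leq_addr.
exact: leq_trans le_x (leq_addl _ _).
Qed.

Lemma size_le_weight (s : seq part) :
  all (fun x => 0 < x.1)%N s -> (size s <= weight s)%N.
Proof.
elim: s => // x s IH /= /andP[x_gt0 /IH le_s]; rewrite weight_cons.
by rewrite -add1n leq_add.
Qed.

Lemma bounded_regularE k m n s : (n <= m)%N -> bounded_regular k m n s =
  [&& is_overpartition s, regular k s & weight s == n].
Proof.
rewrite /bounded_regular /is_overpartition => le_nm.
case: (eqVneq (weight s) n) => [w_s|_]; last by rewrite !andbF.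
rewrite !andbT andbA andbC [RHS]andbC; congr (_ && _); rewrite andbC; congr (_ && _).
case: s w_s => //= x s w_s; case: path; rewrite ?andbF ?andbT //.
have := part_le_weight (mem_head x s); rewrite w_s => /leq_trans/(_ le_nm).
by rewrite /may_precede /= andbT leq_eqVlt orbC.
Qed.

Definition bounded_set (N k i : nat) : {set bounded_parts N} :=
  [set s | [&& is_overpartition (parts s), regular k (parts s)
    & weight (parts s) == i]].

Lemma parts_inj N : injective (@parts N).
Proof.
move=> s t /inj_map eq_st; apply/val_inj/eq_st => -[i b] [j c] /= [eq_ij ->].
by congr (_, _); apply: val_inj.
Qed.

Lemma parts_surj N (s : seq part) : all (fun x => 0 < x.1)%N s ->
  (weight s <= N)%N -> exists t : bounded_parts N, parts t = s.
Proof.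
move=> pos_s le_sN.
have size_s : (size [seq (inord x.1 : 'I_N.+1, x.2) | x <- s] <= N)%N.
  by rewrite size_map (leq_trans (size_le_weight pos_s)).
exists (Bseq size_s); rewrite /parts /= -map_comp map_id_in // => -[i b] x_s /=.
by rewrite inordK // ltnS (leq_trans (part_le_weight x_s)).
Qed.

Lemma card_bounded_set N k i : (i <= N)%N ->
  (#|bounded_set N k i|)%:Z = reg_gf k i.
Proof.
move=> le_iN; have [l [uniq_l mem_l size_l]] := bounded_regular_listing k i i.
rewrite -(reg_prod_stable k (leqnn i)) -size_l; congr Posz.
rewrite cardE -(size_map (@parts N)); apply/perm_size/uniq_perm => //.
  by rewrite map_inj_uniq ?enum_uniq //; apply: parts_inj.
move=> s; rewrite mem_l bounded_regularE //; apply/mapP/idP => [[t] | reg_s].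
  by rewrite mem_enum inE => t_in ->.
have [/andP[pos_s _] _ /eqP w_s] := and3P reg_s.
have [t parts_t] : exists t : bounded_parts N, parts t = s.
  by apply: parts_surj; rewrite ?w_s.
by exists t; rewrite ?mem_enum ?inE ?parts_t.
Qed.

(** Pairs are sorted by the weight of their first component, which gives a
    Cauchy product. *)
Lemma Bbar_gf k n : (Bbar k n)%:Z = (reg_gf k ^+ 2) n.
Proof.
rewrite expr2 coefsM /Bbar -sum1_card.
pose wt (st : bounded_parts n * bounded_parts n) : 'I_n.+1 :=
  inord (weight (parts st.1)).
rewrite (partition_big wt xpredT) // -natz natr_sum; apply: eq_bigr => i _.
have le_in : (i <= n)%N by rewrite -ltnS.
rewrite sum1dep_card natz -!(@card_bounded_set n) ?leq_subr // -PoszM -cardsX.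
congr Posz; apply: eq_card => -[s t]; rewrite !inE /wt /=.
rewrite /is_regular_overpartition_pair.
case: (is_overpartition (parts s)); case: (is_overpartition (parts t)) => //=;
  rewrite ?andbF //.
case: (regular k (parts s)); case: (regular k (parts t)) => //=; rewrite ?andbF //.
rewrite -val_eqE /=; case: (leqP (weight (parts s)) n) => [le_sn|lt_ns].
  by rewrite inordK //; lia.
lia.
Qed.

Lemma dvdn_succ_of_modzN1 (x d : nat) :
  (x%:Z = -1 %[mod d%:Z])%Z -> (d %| x.+1)%N.
Proof.
move/eqP; rewrite eqz_mod_dvd opprK (_ : x%:Z + 1 = x.+1%:Z) ?dvdzE //.
by rewrite -addn1.
Qed.

(** * The congruence *)

(** The prime p is odd, so n and its odd part have the same p-adic valuation. *)
Lemma haupt16_dvd_of_prime n j p :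
  (1 <= j)%N -> (j < 5)%N -> prime p -> (0 < n)%N ->
  (2 ^ j %| p.+1)%N -> (2 ^ (5 - j) %| (logn p n).+1)%N ->
  (16 %| haupt16 n)%Z.
Proof.
move=> j1 j5 p_pr n_gt0 dvd_p dvd_log.
have p_neq2 : (p == 2)%N = false.
  have : (2 %| p.+1)%N.
    by apply: dvdn_trans dvd_p; rewrite -{1}[2%N]expn1 dvdn_exp2l.
  by rewrite dvdn2 /= negbK => odd_p; apply: contraTF odd_p => /eqP ->.
have [m cop_2m nE] := pfactor_coprime (isT : prime 2) n_gt0.
have odd_m : odd m by rewrite -coprime2n.
have log_m : logn p m = logn p n.
  rewrite nE lognM ?expn_gt0 //; last by case: m odd_m {nE cop_2m}.
  by rewrite lognX (logn_prime _ (isT : prime 2)) p_neq2 muln0 addn0.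
rewrite nE mulnC; apply: haupt16_dvd => //; rewrite lambert_odd //.
by rewrite dvdzE /=; apply: (@sigma_dvd16 m j p); rewrite ?log_m.
Qed.

Lemma Bbar_dvd al b n : (0 < n)%N -> (16 %| haupt16 n)%Z ->
  (2 ^ (3 * b + 9) %| Bbar (2 ^ al.+1) (2 ^ (al.+1 + b + 1) * n))%N.
Proof.
move=> n_gt0 w16.
suff : ((2 ^ (3 * b + 9))%N%:Z %| (Bbar (2 ^ al.+1) (2 ^ (al.+1 + b + 1) * n))%:Z)%Z.
  by rewrite dvdzE.
rewrite Bbar_gf (_ : al.+1 + b + 1 = (al + b).+2)%N; last by lia.
rewrite -coefs_iter_bisect.
have [c [d [q ->]]] := valuation_form_iter al b.
have scaleE : 2 * 8 ^+ b = (2 * 8 ^+ b : int)%:~R :> fps.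
  by rewrite rmorphM rmorphXn.
rewrite coefsD coefs1 (_ : (n == 0)%N = false); last by rewrite -leqn0 leqNgt n_gt0.
rewrite add0r scaleE coefs_int.
have -> : (2 ^ (3 * b + 9))%N%:Z = 2 * 8 ^+ b * 256 :> int.
  by rewrite expnD expnM PoszM -[(2 ^ 3)%N]/8%N -natz natrX natz; lia.
apply: dvdz_mul => //.
have -> : c%:~R * haupt + d%:~R * haupt ^+ 2 + 16 * haupt * haupt_poly q =
   c%:~R * (16 * haupt16) + 256 * (d%:~R * haupt16 ^+ 2 + haupt16 * haupt_poly q).
  by rewrite hauptE; ring.
rewrite coefsD coefs_int !coefs_nat; apply: rpredD; last exact: dvdz_mulr.
by case/dvdzP: w16 => t ->; apply/dvdzP; exists (c * t); ring.
Qed.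

Local Close Scope ring_scope.

Theorem corollary1p2 (n j p : nat) (hj1 : 1 <= j) (hj5 : j < 5)
    (hp : prime p)
    (hpj : (p%:Z = -1 %[mod (2 ^ j)%N%:Z])%Z)
    (hnu : ((logn p n.+1)%:Z = -1 %[mod (2 ^ (5 - j))%N%:Z])%Z) :
  forall alpha beta : nat, 1 <= alpha ->
    Bbar (2 ^ alpha) (2 ^ (alpha + beta + 1) * n.+1)
      = 0 %[mod 2 ^ (3 * beta + 9)].
Proof.
case=> // alpha beta _; rewrite mod0n; apply/eqP; apply: Bbar_dvd => //.
exact: (haupt16_dvd_of_prime hj1 hj5 hp (ltn0Sn n)
  (dvdn_succ_of_modzN1 hpj) (dvdn_succ_of_modzN1 hnu)).
Qed.
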